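(* Let $p=Y_i\bowtie Y_j$ be an X-point, let $Y$ be an auxiliary function for $p$, and write the triad $\Omega=[Y_i,Y_j;Y]$ near $p$ as $$\Omega(x)=[U,L;Y](x)=\begin{cases}[I,J;K](x)&\text{if }x\geqslant p\\ [I',J';K'](x)&\text{if }x<p,\end{cases}$$ where $U=\max\{Y_i,Y_j\}$, $L=\min\{Y_i,Y_j\}$ and $I,J,K,I',J',K'$ are affine functions with rational coefficients, so that (near $p$) $J<I<K$ for $x>p$ and $J'<I'<K'$ for $x<p$. Then $\Omega$ determines a homology $\lambda$ of $\mathbb{P}^2(\mathbb{Q})$ with axis the line $po_\infty$ which maps the lines $I$, $J$, $K$ to the lines $I'$, $J'$, $K'$, respectively. This homology induces a self-equivalence of $\Omega$, that is, $f(\Omega(x))=\Omega(\mu(x))$ near $p$, via the pair $(\mu,f)$ given by $$\mu=\left(\frac{K'-I'}{K'-J'}\right)^{-1}\circ\frac{K-I}{K-J}$$ (the exponent $-1$ denoting the inverse of a M\''obius transformation) and $$f(z)=\frac{K'(\mu(x))-I'(\mu(x))}{K(x)-I(x)}\,z+\frac{K(x)\cdot I'(\mu(x))-I(x)\cdot K'(\mu(x))}{K(x)-I(x)}.$$ This (non-trivial, local) self-equivalence is unique up to inversion. The inverse of $\mu$ and the corresponding $f$ are obtained by interchanging all primed and unprimed quantities.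
   Context: All functions are piecewise-affine continuous real functions of one variable with rational coefficients and finitely many pieces on any interval. A function is regular at a point (on an interval) if it is affine near it (on it). If two such functions $Y_i,Y_j$ satisfy $(p-\epsilon,p+\epsilon)\cap\{x\in\mathbb{Q}:Y_i(x)=Y_j(x)\}=\{p\}$ for some $\epsilon>0$ and $p\in\mathbb{Q}$, we write $p=Y_i\bowtie Y_j$ and call $p$ an X-point; the same symbol also denotes the point $(p,Y_i(p))$ of the plane. An auxiliary function $Y$ for $p$ is any such piecewise-affine function not passing through the point $(p,Y_i(p))$; here $Y$ lies above this point. All three functions are assumed regular near $p$ except possibly at $p$. The triad $[Y_i,Y_j;Y]$ is the multiset of these three functions, identified with $[U,L;Y]$; $\Omega(x)$ is the multiset of their values at $x$, and affine maps act on multisets elementwise. The point $(x,y)\in\mathbb{Q}^2$ is identified with the projective point $(x,y,1)\in\mathbb{P}^2(\mathbb{Q})$; $o_\infty=(0,1,0)$ is the point at infinity of the vertical direction. The symbol of an affine function also denotes its graph, a line. A homology is a projective collineation with a line of fixed points (the axis) and one additional fixed point (the centre) not on the axis. A local self-equivalence of $\Omega$ via $(\mu,f)$ means $f(\Omega(x))=\Omega(\mu(x))$ for $x$ sufficiently close to $p$, where $\mu$ is a M\''obius transformation with rational coefficients and $f(z)=A(x)z+B(x)$ is an affine transformation with coefficients $A,B\in\mathbb{Q}(x)$. With the displayed formulae, $\mu$ carries a right neighbourhood of $p$ to a left neighbourhood, so the displayed pair is applied to $x\geqslant p$, with $f(I(x))=I'(\mu(x))$, $f(J(x))=J'(\mu(x))$,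 $f(K(x))=K'(\mu(x))$; for $x<p$ one uses the inverse pair, obtained by interchanging primed and unprimed quantities. *)

(* Defs.v *)
(* MathComp / MathComp-Analysis *)
From HB Require Import structures.
From mathcomp Require Import all_boot all_order all_algebra.
From mathcomp Require Import all_classical all_reals all_analysis.
Set Implicit Arguments.
Unset Strict Implicit.
Unset Printing Implicit Defensive.
Import Order.TTheory GRing.Theory Num.Theory numFieldNormedType.Exports.
Local Open Scope classical_set_scope.
Local Open Scope ring_scope.

Definition evalq (F : numFieldType) (q : {poly rat}) (x : F) : F :=
  (map_poly ratr q).[x].

(* [size q] is the degree plus one; constants count as affine functions. *)
Definition affine (q : {poly rat}) : Prop := (size q <= 2)%N.

Definition affine_on (R : realType) (f : R -> R) (a b : R) : Prop :=
  exists2 q : {poly rat}, affine q & {in `[a, b], forall x, f x = evalq q x}.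

(* Finitely many pieces on every bounded interval; infinitely many overall are
   allowed. *)
Definition piecewise_affine (R : realType) (f : R -> R) : Prop :=
  continuous f /\
  forall a b : R, a <= b -> exists2 s : seq R, itv_partition a b s &
    forall i : nat, (i < size s)%N ->
      affine_on f (nth 0 (a :: s) i) (nth 0 s i).

Definition regular_at (R : realType) (f : R -> R) (x0 : R) : Prop :=
  exists2 q : {poly rat}, affine q & \forall x \near x0, f x = evalq q x.

Definition regular_off (R : realType) (f : R -> R) (p : R) : Prop :=
  \forall x \near p^', regular_at f x.

Definition X_point (R : realType) (f g : R -> R) (p : rat) : Prop :=
  exists2 e : R, 0 < e &
    [set x : rat | ratr x \in `]ratr p - e, ratr p + e[] `&`
    [set x : rat | f (ratr x) = g (ratr x)] = [set p].

(* A multiset is a list up to [perm_eq]. *)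
Definition triad (R : realType) (f g h : R -> R) (x : R) : seq R :=
  [:: f x; g x; h x].

Definition proportional (m n : nat) (A B : 'M[rat]_(m, n)) : Prop :=
  exists2 c : rat, c != 0 & A = c *: B.

(* P^2(Q): a point is the row space of a nonzero row vector, a line the row
   space of a rank 2 matrix, incidence is inclusion of row spaces, and
   collineations are invertible matrices acting on the right, up to scaling. *)
Definition pt (x y : rat) : 'rV[rat]_3 :=
  \row_(j < 3) [:: x; y; 1]`_j.

Definition o_infty : 'rV[rat]_3 := \row_(j < 3) [:: 0; 1; 0]`_j.

Definition join (u v : 'rV[rat]_3) : 'M[rat]_3 := (u + v)%MS.

Definition graph_line (q : {poly rat}) : 'M[rat]_3 :=
  join (pt 0 q.[0]) (pt 1 q.[1]).

(* The final equivalence makes the centre the only fixed point off the axis. *)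
Definition homology (lam axis : 'M[rat]_3) : Prop :=
  [/\ lam \in unitmx, \rank axis = 2%N &
      exists C : 'rV[rat]_3,
        [/\ C != 0, ~~ (C <= axis)%MS &
            forall P : 'rV[rat]_3, P != 0 ->
              (P *m lam == P)%MS = (P <= axis)%MS || (P == C)%MS]].

Notation ratfun := {fraction {poly rat}}.
Definition rf (q : {poly rat}) : ratfun := FracField.tofrac q.
Definition rfC (c : rat) : ratfun := rf c%:P.

(* [phi] is defined at [x], with value [v]. *)
Definition rf_value (F : numFieldType) (phi : ratfun) (x v : F) : Prop :=
  exists n d : {poly rat},
    [/\ phi = rf n / rf d, evalq d x != 0 & v = evalq n x / evalq d x].

(* The matrix [a b; c d] represents the Moebius transformation
   x |-> (a x + b) / (c x + d); the matrix product represents composition, and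
   proportional matrices represent the same transformation. *)
Definition mob_den (F : numFieldType) (M : 'M[rat]_2) (x : F) : F :=
  ratr (M 1 0) * x + ratr (M 1 1).

Definition mob (F : numFieldType) (M : 'M[rat]_2) (x : F) : F :=
  (ratr (M 0 0) * x + ratr (M 0 1)) / mob_den M x.

Definition mob_rf (M : 'M[rat]_2) : ratfun :=
  (rfC (M 0 0) * rf 'X + rfC (M 0 1)) / (rfC (M 1 0) * rf 'X + rfC (M 1 1)).

(* The quotient u / v of two affine functions. *)
Definition mob_quot (u v : {poly rat}) : 'M[rat]_2 :=
  \matrix_(i < 2, j < 2) (if i == 0 then u else v)`_(1 - j)%N.

Definition rf_comp (q : {poly rat}) (phi : ratfun) : ratfun :=
  (map_poly rfC q).[phi].

(* The pair (mu, f) with f(z) = A(x) z + B(x). *)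
Record mpair := MPair { mp_mu : 'M[rat]_2; mp_A : ratfun; mp_B : ratfun }.

Definition f_value (F : numFieldType) (E : mpair) (x a b : F) : Prop :=
  rf_value (mp_A E) x a /\ rf_value (mp_B E) x b.

Definition same_pair (E E' : mpair) : Prop :=
  [/\ proportional (mp_mu E) (mp_mu E'), mp_A E = mp_A E' & mp_B E = mp_B E'].

Definition trivial_pair : mpair := MPair 1%:M 1 0.

(* f(Omega(x)) = Omega(mu(x)) for one x *)
Definition equivalence_at (R : realType) (Om : R -> seq R) (E : mpair) (x : R)
    : Prop :=
  mob_den (mp_mu E) x != 0 /\
  exists a b : R, [/\ f_value E x a b, a != 0 &
    perm_eq [seq a * z + b | z <- Om x] (Om (mob (mp_mu E) x))].

(* The self-equivalence holds for the points of [S] close to [p], where [S] is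
   one of the two sides of [p]: a pair and its inverse are used on opposite
   sides.  It is local: [mu] maps neighbourhoods of [p] to neighbourhoods of
   [p], that is, it fixes [p]. *)
Definition self_equivalence (R : realType) (p : rat) (S : pred R)
    (Om : R -> seq R) (E : mpair) : Prop :=
  [/\ mp_mu E \in unitmx,
      mob_den (mp_mu E) (ratr p : R) != 0,
      mob (mp_mu E) (ratr p : R) = ratr p &
      \forall x \near (ratr p : R), S x -> equivalence_at Om E x].

Definition maps_branches (R : realType) (E : mpair) (x : R)
    (I J K I' J' K' : {poly rat}) : Prop :=
  let y := mob (mp_mu E) x in
  forall a b : R, f_value E x a b ->
    [/\ a * evalq I x + b = evalq I' y, a * evalq J x + b = evalq J' y
      & a * evalq K x + b = evalq K' y].

(* mu' is the inverse of mu and the map f' at mu(x) is the inverse of the map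
   f at x. *)
Definition inverse_pair (R : realType) (p : rat) (E E' : mpair) : Prop :=
  proportional (mp_mu E') (invmx (mp_mu E)) /\
  \forall x \near (ratr p : R), mob_den (mp_mu E) x != 0 /\
    exists a b a' b' : R,
      [/\ f_value E x a b, f_value E' (mob (mp_mu E) x) a' b' &
          forall z : R, a' * (a * z + b) + b' = z].

(* The collineation acts as (x, z) |-> (mu(x), f(z)) on finite points. *)
Definition induces (lam : 'M[rat]_3) (E : mpair) : Prop :=
  forall x z a b : rat, mob_den (mp_mu E) x != 0 -> f_value E x a b ->
    (pt x z *m lam == pt (mob (mp_mu E) x) (a * z + b))%MS.

Definition std_mu (I J K I' J' K' : {poly rat}) : 'M[rat]_2 :=
  invmx (mob_quot (K' - I') (K' - J')) *m mob_quot (K - I) (K - J).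

Definition std_pair (I J K I' J' K' : {poly rat}) : mpair :=
  let M := std_mu I J K I' J' K' in
  let I'mu := rf_comp I' (mob_rf M) in
  let K'mu := rf_comp K' (mob_rf M) in
  MPair M ((K'mu - I'mu) / (rf K - rf I))
          ((rf K * I'mu - rf I * K'mu) / (rf K - rf I)).

(* Main.v *)
Require Import Defs.
From HB Require Import structures.
From mathcomp Require Import all_boot all_order all_algebra.
From mathcomp Require Import all_classical all_reals all_analysis.
From mathcomp Require Import ring lra.
Import Order.TTheory GRing.Theory Num.Theory numFieldNormedType.Exports.
Local Open Scope classical_set_scope.
Local Open Scope ring_scope.

(** Measure abscissae from the X-point, with t = x - p. The functions U and L have
    a common value c at p, and Y has a value c + h there with h > 0, so

      I = c + i t,   J = c + j t,   K = c + h + k t,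

    and by continuity the primed functions have the same form with slopes i', j',
    k' ([triad_normal_form]). Put d = i - j and d' = i' - j'. Since U and L meet
    only at p close to p, d > 0 > d' ([X_point_opening]): the side of p described by a triple
    of slopes is the one where d t >= 0.

    Consider the linear map

      (t, z, 1) |-> (h d t, h d' z + b t, h d' + w t),

    where w = d' (k - j) - d (k' - j') and b = c w + h (i' d - d' i). It multiplies
    the vectors of the line t = 0 by h d', and its third eigenvalue is h d. As
    d and d' differ, it is a homology with axis t = 0 ([rank1_homology],
    [hom_mx_homology]). It maps I, J, K to I', J', K' ([hom_mx_determined]), and
    these conditions are linear equations that leave only a scalar factor free
    ([hom_mx_unique]). Dividing by the last coordinate D = h d' + w t, the
    collineation acts by t |-> h d t / D on the abscissae and by
    z |-> (h d' z + b t) / D on the ordinates. This is the pair of the statement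
    ([std_muE], [std_coeffs]). Exchanging primed and unprimed quantities
    exchanges d and d' and negates w and b, which inverts the collineation
    ([hom_mx_swap], [std_inverse]). As d and d' have opposite signs, mu exchanges
    the two sides of p, and the branches are matched one by one.

    For uniqueness, note that close to p the difference I - J is much smaller than
    K - I. So an affine map of the values that carries a triple of values to
    another one preserves the order and matches I, J, K with their counterparts
    ([affine_match]). The quotient (K - I) / (K - J) is invariant under affine
    maps and is a Moebius transformation of x, different from a constant, so mu is
    determined by the side to which it maps, and so is f ([matched_pair]). A
    Moebius transformation that fixes p preserves the two sides or exchanges
    them. In the first case the pair must be trivial, because the trivial pair is
    a solution ([std_diag_trivial]). In the second case it is the pair found above
    ([self_equivalence_unique]). *)

(** * Affine functions centred at a point *)

Definition line (p c m : rat) : {poly rat} := c%:P + m *: ('X - p%:P).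

Lemma affine_line p c m : affine (line p c m).
Proof.
rewrite /affine /line; apply: (leq_trans (size_polyD _ _)).
rewrite geq_max (leq_trans (size_polyC_leq1 _)) //=.
by apply: (leq_trans (size_scale_leq _ _)); rewrite size_XsubC.
Qed.

Lemma coef1_line p c m : (line p c m)`_1 = m.
Proof. by rewrite !coefE /= subr0 mulr1 add0r. Qed.

Lemma coef0_line p c m : (line p c m)`_0 = c - m * p.
Proof. by rewrite !coefE /= sub0r mulrN. Qed.

Lemma horner_line p c m x : (line p c m).[x] = c + m * (x - p).
Proof. by rewrite /line !hornerE. Qed.

(** Two affine functions with the same value at [x] can thus be compared by
    their slopes. *)
Lemma affineE (q : {poly rat}) x : affine q -> q = line x q.[x] q`_1.
Proof.
move=> aq; apply/polyP=> -[|[|i]].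
- rewrite coef0_line; have -> : q.[x] = q`_0 + q`_1 * x.
    rewrite (horner_coef_wide _ aq) !big_ord_recl big_ord0 /=.
    by rewrite expr0 expr1 mulr1 addr0.
  by ring.
- by rewrite coef1_line.
- rewrite (nth_default _ (leq_trans aq _)) //.
  by rewrite (nth_default _ (leq_trans (affine_line _ _ _) _)).
Qed.

Lemma evalq_line (F : numFieldType) p c m (x : F) :
  evalq (line p c m) x = ratr c + ratr m * (x - ratr p).
Proof.
rewrite /evalq /line rmorphD /= map_polyZ /= map_polyC /= rmorphB /= map_polyC map_polyX /=.
by rewrite !hornerE.
Qed.

Lemma evalqM (F : numFieldType) (q r : {poly rat}) (x : F) :
  evalq (q * r) x = evalq q x * evalq r x.
Proof. by rewrite /evalq rmorphM hornerM. Qed.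

Lemma evalqB (F : numFieldType) (q r : {poly rat}) (x : F) :
  evalq (q - r) x = evalq q x - evalq r x.
Proof. by rewrite /evalq rmorphB !hornerE. Qed.

Lemma evalq_ratr (F : numFieldType) (q : {poly rat}) (x : rat) :
  evalq q (ratr x : F) = ratr q.[x].
Proof. by rewrite /evalq horner_map. Qed.

Lemma lineB p c m c' m' :
  line p c m - line p c' m' = line p (c - c') (m - m').
Proof. by rewrite /line scalerBl polyCB; ring. Qed.

Lemma line_neq0 p c m : c != 0 -> line p c m != 0.
Proof.
apply: contraNneq => /(congr1 (horner^~ p)) /=.
by rewrite horner_line hornerE subrr mulr0 addr0 => ->.
Qed.

(** * Values of rational functions *)

Lemma rfM (q r : {poly rat}) : rf (q * r) = rf q * rf r.
Proof. exact: rmorphM. Qed.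

Lemma rf_eq0 (q : {poly rat}) : (rf q == 0) = (q == 0).
Proof. exact: tofrac_eq0. Qed.

Lemma rfC_is_zmod : zmod_morphism rfC.
Proof. by move=> a b; rewrite /rfC polyCB; exact: rmorphB. Qed.

Lemma rfC_is_monoid : monoid_morphism rfC.
Proof.
split=> [|a b]; rewrite /rfC; first exact: rmorph1.
by rewrite polyCM; exact: rmorphM.
Qed.
HB.instance Definition _ := GRing.isZmodMorphism.Build rat ratfun rfC rfC_is_zmod.
HB.instance Definition _ :=
  GRing.isMonoidMorphism.Build rat ratfun rfC rfC_is_monoid.

Lemma rf_line p c m : rf (line p c m) = rfC c + rfC m * (rf 'X - rfC p).
Proof.
by rewrite /line -mul_polyC /rf rmorphD rmorphM rmorphB.
Qed.

Lemma rf_comp_line p c m phi :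
  rf_comp (line p c m) phi = rfC c + rfC m * (phi - rfC p).
Proof.
rewrite /rf_comp /line rmorphD /= map_polyZ /= map_polyC /= rmorphB /= map_polyC map_polyX /=.
by rewrite !hornerE.
Qed.

(** Cross-multiplied, so that the given representation [n / d] may have its
    denominator vanishing at [x]; only the representation hidden in the
    hypothesis has to be defined there. *)
Lemma rf_value_eq (F : numFieldType) (n d : {poly rat}) (x v : F) : d != 0 ->
  rf_value (rf n / rf d) x v -> v * evalq d x = evalq n x.
Proof.
move=> d0 [n1 [d1 [E d1x ->]]].
have d10 : d1 != 0.
  by apply: contraNneq d1x => ->; rewrite /evalq rmorph0 hornerE.
move/eqP: E; rewrite eqr_div ?rf_eq0 // -!rfM => /eqP E.
have {}E : n * d1 = n1 * d by apply/eqP; rewrite -subr_eq0 -rf_eq0 /rf rmorphB subr_eq0; apply/eqP.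
by rewrite mulrAC -evalqM -E evalqM mulfK.
Qed.

Lemma rf_valueI (F : numFieldType) (n d : {poly rat}) (x : F) :
  evalq d x != 0 -> rf_value (rf n / rf d) x (evalq n x / evalq d x).
Proof. by move=> dx; exists n, d. Qed.

(** * Coordinates at the X-point *)

(** The data shared by the two sides of the X-point: its coordinates, and the
    height of the auxiliary function above it. *)
Record frame := Frame { vx : rat; vy : rat; gap : rat }.

(** The data that tell the two sides apart. A side is represented by its slopes,
    so that exchanging primed and unprimed quantities is exchanging [m] and [n]. *)
Record slopes := Slopes { slopeI : rat; slopeJ : rat; slopeK : rat }.

Definition lineI F m := line (vx F) (vy F) (slopeI m).
Definition lineJ F m := line (vx F) (vy F) (slopeJ m).
Definition lineK F m := line (vx F) (vy F + gap F) (slopeK m).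
(** The difference I - J is [opening m] times the displacement from the X-point.
    Its sign tells which side is described by [m], namely the side where J <= I. *)
Definition opening m := slopeI m - slopeJ m.

(** The coefficient w of the denominator h d' + w t of mu. *)
Definition skew m n :=
  opening n * (slopeK m - slopeJ m) - opening m * (slopeK n - slopeJ n).

(** The coefficient of t in the translation part of f, before division by
    h d' + w t. *)
Definition shear F m n :=
  vy F * skew m n + gap F * (slopeI n * opening m - opening n * slopeI m).
Definition mu_den F m n := line (vx F) (gap F * opening n) (skew m n).

(** The numerator of p + h d t / (h d' + w t), expanded around p. *)
Definition mu_num F m n :=
  line (vx F) (vx F * (gap F * opening n)) (vx F * skew m n + gap F * opening m).

Definition std_of F m n :=
  std_pair (lineI F m) (lineJ F m) (lineK F m) (lineI F n) (lineJ F n) (lineK F n).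

(** * Explicit form of the pair *)

Lemma det_mob_quot p c m c' m' :
  \det (mob_quot (line p c m) (line p c' m')) = m * c' - m' * c.
Proof.
rewrite (expand_det_row _ 0) !big_ord_recl big_ord0 /cofactor !det_mx11 !mxE /=.
rewrite !(coef0_line, coef1_line) /=; ring.
Qed.

Lemma mob_quot_unit p c m c' m' : m * c' != m' * c ->
  mob_quot (line p c m) (line p c' m') \in unitmx.
Proof. by rewrite unitmxE det_mob_quot unitfE subr_eq0. Qed.

Lemma KI_line F m : lineK F m - lineI F m = line (vx F) (gap F) (slopeK m - slopeI m).
Proof. by rewrite lineB; congr line; ring. Qed.

Lemma KJ_line F m : lineK F m - lineJ F m = line (vx F) (gap F) (slopeK m - slopeJ m).
Proof. by rewrite lineB; congr line; ring. Qed.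

Lemma ratio_unit F m : gap F != 0 -> opening m != 0 ->
  mob_quot (lineK F m - lineI F m) (lineK F m - lineJ F m) \in unitmx.
Proof.
rewrite KI_line KJ_line /opening => h0 d0; apply: mob_quot_unit.
by apply: contraNneq d0 => /(mulIf h0) E; apply/eqP; lra.
Qed.

(** Clearing denominators in (K' - I') / (K' - J') o mu = (K - I) / (K - J): the
    product of the matrix on the left with the explicit matrix of mu is h d'
    times the matrix on the right. *)
Lemma std_muE F m n : gap F != 0 -> opening n != 0 ->
  mp_mu (std_of F m n) = (gap F * opening n)^-1 *: mob_quot (mu_num F m n) (mu_den F m n).
Proof.
move=> h0 d0; rewrite /= /std_mu.
have U := ratio_unit F n h0 d0; set N := mob_quot _ _ in U *.
apply: (canRL (scalerK _)); first by rewrite mulf_neq0.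
rewrite scalemxAr.
apply: (canLR (mulKmx U)).
rewrite /N !KI_line !KJ_line.
apply/matrixP=> a b.
rewrite !mxE !big_ord_recl big_ord0 !mxE /mu_num /mu_den /skew /opening /=.
case: a => -[|[|//]] ia; case: b => -[|[|//]] ib /=;
rewrite !(coef0_line, coef1_line); ring.
Qed.

Lemma mob_denZ (F : numFieldType) (s : rat) M (x : F) :
  mob_den (s *: M) x = ratr s * mob_den M x.
Proof. by rewrite /mob_den !mxE !rmorphM /= mulrDr mulrA. Qed.

Lemma mobZ (F : numFieldType) (s : rat) M (x : F) : s != 0 ->
  mob (s *: M) x = mob M x.
Proof.
move=> s0; rewrite /mob mob_denZ !mxE !rmorphM /= -(mulrA (ratr s)) -mulrDr.
by rewrite -mulf_div divff ?mul1r // fmorph_eq0.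
Qed.

Lemma mob_rfZ (s : rat) M : s != 0 -> mob_rf (s *: M) = mob_rf M.
Proof.
move=> s0; rewrite /mob_rf !mxE !rmorphM /= -!(mulrA (rfC s)) -!mulrDr.
by rewrite -mulf_div divff ?mul1r // fmorph_eq0.
Qed.

Lemma mob_den_quot (F : numFieldType) u p c m (x : F) :
  mob_den (mob_quot u (line p c m)) x = evalq (line p c m) x.
Proof.
rewrite /mob_den !mxE /= coef1_line coef0_line evalq_line rmorphB rmorphM /=; ring.
Qed.

Lemma mob_quotE (F : numFieldType) p c m c' m' (x : F) :
  mob (mob_quot (line p c m) (line p c' m')) x =
  evalq (line p c m) x / evalq (line p c' m') x.
Proof.
rewrite /mob mob_den_quot; congr (_ / _).
rewrite !mxE /= coef1_line coef0_line evalq_line rmorphB rmorphM /=; ring.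
Qed.

Lemma mob_rf_quot p c m c' m' :
  mob_rf (mob_quot (line p c m) (line p c' m')) =
  rf (line p c m) / rf (line p c' m').
Proof.
rewrite /mob_rf !mxE /= !coef1_line !coef0_line !rf_line !rmorphB !rmorphM /=.
by congr (_ / _); ring.
Qed.

Lemma mu_den_neq0 F m n : gap F != 0 -> opening n != 0 -> mu_den F m n != 0.
Proof. by move=> h0 d0; rewrite line_neq0 // mulf_neq0. Qed.

Lemma std_mob_rf F m n : gap F != 0 -> opening n != 0 ->
  mob_rf (mp_mu (std_of F m n)) = rf (mu_num F m n) / rf (mu_den F m n).
Proof.
move=> h0 d0; rewrite std_muE // mob_rfZ ?mob_rf_quot //.
by rewrite invr_eq0 mulf_neq0.
Qed.

(** Here [t] is the displacement from p and [s] its image under mu; the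
    dilation K' - I' over K - I simplifies because K - I divides the numerator
    of K'(mu) - I'(mu). *)
Lemma std_A_identity (F : fieldType) (t c h i j k i' j' k' : F) :
  let w := (i' - j') * (k - j) - (i - j) * (k' - j') in
  let D := h * (i' - j') + w * t in
  let s := (h * (i - j) * t) / D in
  D != 0 -> c + h + k * t - (c + i * t) != 0 ->
  (c + h + k' * s - (c + i' * s)) / (c + h + k * t - (c + i * t)) =
  h * (i' - j') / D.
Proof.
move=> w D s D0 KI0; apply/eqP; rewrite eqr_div //; apply/eqP.
by rewrite /s /D /w; field; rewrite -/w -/D.
Qed.

Lemma std_B_identity (F : fieldType) (t c h i j k i' j' k' : F) :
  let w := (i' - j') * (k - j) - (i - j) * (k' - j') in
  let D := h * (i' - j') + w * t in
  let s := (h * (i - j) * t) / D in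
  D != 0 -> c + h + k * t - (c + i * t) != 0 ->
  ((c + h + k * t) * (c + i' * s) - (c + i * t) * (c + h + k' * s)) /
    (c + h + k * t - (c + i * t)) =
  (c * w + h * (i' * (i - j) - (i' - j') * i)) * t / D.
Proof.
move=> w D s D0 KI0; apply/eqP; rewrite eqr_div //; apply/eqP.
by rewrite /s /D /w; field; rewrite -/w -/D.
Qed.

Lemma mu_shift_identity (F : fieldType) (x p q r s : F) :
  q + r * (x - p) != 0 ->
  (p * q + (p * r + s) * (x - p)) / (q + r * (x - p)) - p =
  s * (x - p) / (q + r * (x - p)).
Proof. by move=> D0; field. Qed.

Lemma rf_mu_shift p q r s : line p q r != 0 ->
  rf (line p (p * q) (p * r + s)) / rf (line p q r) - rfC p =
  rfC s * (rf 'X - rfC p) / rf (line p q r).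
Proof.
rewrite -rf_eq0 !rf_line !(rmorphD, rmorphM) /=; exact: mu_shift_identity.
Qed.

(** The common denominator of mu, A and B is the last coordinate of the homology. *)
Lemma std_coeffs F m n : gap F != 0 -> opening n != 0 ->
  mp_A (std_of F m n) = rf (gap F * opening n)%:P / rf (mu_den F m n) /\
  mp_B (std_of F m n) = rf (line (vx F) 0 (shear F m n)) / rf (mu_den F m n).
Proof.
move=> h0 d0; have /= E := std_mob_rf F m n h0 d0; rewrite /= E.
have := mu_den_neq0 F m n h0 d0; rewrite -rf_eq0 => D0.
have : rf (lineK F m) - rf (lineI F m) != 0.
  by rewrite -[_ - _]rmorphB -/(rf _) rf_eq0 KI_line line_neq0.
have S := rf_mu_shift _ _ _ (gap F * opening m) (mu_den_neq0 F m n h0 d0).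
move: D0; rewrite /lineI /lineK !rf_comp_line [X in rfC (slopeK n) * X]S
  [X in rfC (slopeI n) * X]S.
rewrite /mu_den !rf_line -/(rfC (gap F * opening n)) /shear /skew /opening.
rewrite !(rmorphB, rmorphD, rmorphM, rmorph0) /= add0r.
move=> D0 KI0.
have A := std_A_identity ratfun (rf 'X - rfC (vx F)) (rfC (vy F)) (rfC (gap F))
  (rfC (slopeI m)) (rfC (slopeJ m)) (rfC (slopeK m))
  (rfC (slopeI n)) (rfC (slopeJ n)) (rfC (slopeK n)).
have B := std_B_identity ratfun (rf 'X - rfC (vx F)) (rfC (vy F)) (rfC (gap F))
  (rfC (slopeI m)) (rfC (slopeJ m)) (rfC (slopeK m))
  (rfC (slopeI n)) (rfC (slopeJ n)) (rfC (slopeK n)).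
split; [exact (A D0 KI0) | exact (B D0 KI0)].
Qed.

(** * Values of the pair *)

Lemma std_mu_unit F m n : gap F != 0 -> opening m != 0 -> opening n != 0 ->
  mp_mu (std_of F m n) \in unitmx.
Proof.
move=> h0 dm dn; rewrite /= /std_mu unitmx_mul unitmx_inv.
by rewrite !ratio_unit.
Qed.

Lemma std_mob_den (F : numFieldType) G m n (x : F) : gap G != 0 -> opening n != 0 ->
  (mob_den (mp_mu (std_of G m n)) x != 0) = (evalq (mu_den G m n) x != 0).
Proof.
move=> h0 dn; rewrite std_muE // mob_denZ mob_den_quot mulf_eq0 fmorph_eq0.
by rewrite invr_eq0 mulf_eq0 (negPf h0) (negPf dn).
Qed.

Lemma std_mob (F : numFieldType) G m n (x : F) : gap G != 0 -> opening n != 0 ->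
  evalq (mu_den G m n) x != 0 ->
  mob (mp_mu (std_of G m n)) x =
  ratr (vx G) + ratr (gap G * opening m) * (x - ratr (vx G)) / evalq (mu_den G m n) x.
Proof.
move=> h0 dn D0; rewrite std_muE // mobZ ?invr_eq0 ?mulf_neq0 // mob_quotE.
move: D0; rewrite !evalq_line (rmorphD ratr (vx G * skew m n)) !(rmorphM ratr (vx G)) /= => D0.
by rewrite -[LHS](subrK (ratr (vx G))) mu_shift_identity // addrC.
Qed.

Lemma evalqC (F : numFieldType) c (x : F) : evalq c%:P x = ratr c.
Proof. by rewrite /evalq map_polyC hornerC. Qed.

(** The formula of the pair divides by K - I, but its value is also
    determined at the zeros of K - I. *)
Lemma std_f_value (F : numFieldType) G m n (x a b : F) :
  gap G != 0 -> opening n != 0 -> evalq (mu_den G m n) x != 0 ->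
  f_value (std_of G m n) x a b <->
  a = ratr (gap G * opening n) / evalq (mu_den G m n) x /\
  b = ratr (shear G m n) * (x - ratr (vx G)) / evalq (mu_den G m n) x.
Proof.
move=> h0 dn D0; rewrite /f_value; have [-> ->] := std_coeffs G m n h0 dn.
have d0 := mu_den_neq0 G m n h0 dn; split.
- move=> [/(rf_value_eq _ _ _ _ _ d0) + /(rf_value_eq _ _ _ _ _ d0)].
  rewrite evalqC evalq_line rmorph0 add0r => Ea Eb.
  by split; apply: canRL (mulfK D0) _.
- move=> [-> ->]; have := rf_valueI _ (line (vx G) 0 (shear G m n)) _ _ D0.
  have := rf_valueI _ (gap G * opening n)%:P _ _ D0.
  by rewrite evalqC evalq_line rmorph0 add0r.
Qed.

(** I and K are matched by the choice of f; J is matched because mu preserves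
    the ratio of differences (K - I) / (K - J). *)
Lemma std_branch_identity (F : fieldType) (t c h i j k i' j' k' : F) :
  let w := (i' - j') * (k - j) - (i - j) * (k' - j') in
  let D := h * (i' - j') + w * t in
  let a := h * (i' - j') / D in
  let b := (c * w + h * (i' * (i - j) - (i' - j') * i)) * t / D in
  let s := (h * (i - j) * t) / D in
  D != 0 ->
  [/\ a * (c + i * t) + b = c + i' * s, a * (c + j * t) + b = c + j' * s &
      a * (c + h + k * t) + b = c + h + k' * s].
Proof.
move=> w D a b s D0; split; rewrite /a /b /s /D /w; field; exact: D0.
Qed.

Lemma std_maps_branches (R : realType) G m n (x : R) :
  gap G != 0 -> opening n != 0 -> evalq (mu_den G m n) x != 0 ->
  maps_branches (std_of G m n) x
    (lineI G m) (lineJ G m) (lineK G m) (lineI G n) (lineJ G n) (lineK G n).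
Proof.
move=> h0 dn D0 y a b; rewrite (std_f_value _ _ _ _ _ _ _ h0 dn D0) => -[-> ->].
rewrite /y std_mob // !evalq_line /lineI /lineJ /lineK.
have E : forall z : R, ratr (vx G) + z - ratr (vx G) = z by move=> z; rewrite addrC addKr.
rewrite !E; move: D0; rewrite /mu_den evalq_line /shear /skew /opening.
rewrite !(rmorphB, rmorphD, rmorphM) /= => D0.
have [] := std_branch_identity R (x - ratr (vx G)) (ratr (vy G)) (ratr (gap G))
  (ratr (slopeI m)) (ratr (slopeJ m)) (ratr (slopeK m))
  (ratr (slopeI n)) (ratr (slopeJ n)) (ratr (slopeK n)) D0.
by split.
Qed.

(** * Points and lines of the projective plane *)

Lemma ratr_rat (x : rat) : ratr x = x.
Proof. by rewrite -(fmorph_eq_rat idfun). Qed.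

Lemma joinP (u v P : 'rV[rat]_3) :
  (P <= join u v)%MS <-> exists a b, P = a *: u + b *: v.
Proof.
split=> [/sub_addsmxP[[A B]] /= ->|[a [b ->]]].
  by exists (A 0 0), (B 0 0); rewrite {1}[A]mx11_scalar {1}[B]mx11_scalar !mul_scalar_mx.
by rewrite addmx_sub_adds // scalemx_sub.
Qed.

Lemma pt_eqP (u v : 'rV[rat]_3) : v != 0 ->
  (u == v)%MS <-> exists2 k, k != 0 & u = k *: v.
Proof.
move=> v0; split=> [/andP[/sub_rVP[k E] vu]|[k k0 ->]]; last first.
  by apply/eqmxP; exact: eqmx_scale.
exists k => //; apply: contraNneq v0 => k0.
by move: vu; rewrite E k0 scale0r => /submx0null ->.
Qed.

Lemma row3P (u v : 'rV[rat]_3) :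
  u 0 0 = v 0 0 -> u 0 1 = v 0 1 -> u 0 2 = v 0 2 -> u = v.
Proof.
move=> e0 e1 e2; apply/rowP=> -[[|[|[|//]]] i].
- by rewrite (_ : Ordinal i = 0) //; apply: val_inj.
- by rewrite (_ : Ordinal i = 1) //; apply: val_inj.
- by rewrite (_ : Ordinal i = 2) //; apply: val_inj.
Qed.

Lemma axisP (p c : rat) (P : 'rV[rat]_3) :
  (P <= join (pt p c) o_infty)%MS <-> P 0 0 - p * P 0 2 = 0.
Proof.
rewrite joinP; split=> [[a [b ->]]|E].
  by rewrite !mxE /=; ring.
exists (P 0 2), (P 0 1 - c * P 0 2); apply: row3P; rewrite !mxE /=; lra.
Qed.

Lemma graph_lineP p c m (P : 'rV[rat]_3) :
  (P <= graph_line (line p c m))%MS <->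
  P 0 1 = c * P 0 2 + m * (P 0 0 - p * P 0 2).
Proof.
rewrite joinP !horner_line; split=> [[a [b ->]]|E].
  by rewrite !mxE /=; ring.
exists (P 0 2 - P 0 0), (P 0 0); apply: row3P; rewrite ?mxE /= ?E; ring.
Qed.

(** * The homology *)

(** The linear form t = x - p z in homogeneous coordinates (x, y, z), whose
    kernel is the axis. *)
Definition axis_form p : 'cV[rat]_3 := \col_(j < 3) [:: 1; 0; - p]`_j.

Lemma mul_axis_form p (v : 'rV[rat]_3) :
  v *m axis_form p = (v 0 0 - p * v 0 2)%:M.
Proof.
rewrite [LHS]mx11_scalar; congr _%:M.
rewrite !mxE !big_ord_recl big_ord0 !mxE /=.
have -> : lift ord0 (lift ord0 ord0) = 2 :> 'I_3 by apply: val_inj.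
by rewrite mulr0 mulr1 mulrN mulrC add0r addr0.
Qed.

(** The matrix g + t C multiplies the kernel of t by [g] and [C] by [g + k], where
    [k] is the value of t at [C]. These eigenspaces span the plane and belong to
    distinct eigenvalues, so nothing else is fixed. *)
Lemma rank1_homology p c (g : rat) (C : 'rV[rat]_3) :
  let k := C 0 0 - p * C 0 2 in g != 0 -> k != 0 -> g + k != 0 ->
  homology (g%:M + axis_form p *m C) (join (pt p c) o_infty).
Proof.
move=> k g0 k0 gk0; set M := _ + _; set axis := join _ _.
have act (v : 'rV[rat]_3) : v *m M = g *: v + (v 0 0 - p * v 0 2) *: C.
  by rewrite mulmxDr mul_mx_scalar mulmxA mul_axis_form mul_scalar_mx.
have tact (v : 'rV[rat]_3) : (v *m M) 0 0 - p * (v *m M) 0 2 = (g + k) * (v 0 0 - p * v 0 2).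
  by rewrite act !mxE /k; ring.
have Maxis (v : 'rV[rat]_3) : v 0 0 - p * v 0 2 = 0 -> v *m M = g *: v.
  by rewrite act => ->; rewrite scale0r addr0.
have C0 : C != 0 by apply: contraNneq k0 => C0; rewrite /k C0 !mxE mulr0 subr0.
split.
- rewrite -row_free_unit; apply: inj_row_free => v vM.
  have t0 : v 0 0 - p * v 0 2 = 0.
    have := tact v; rewrite vM !mxE mulr0 subr0 => /esym/eqP.
    by rewrite mulf_eq0 (negPf gk0) => /eqP.
  by move: vM; rewrite Maxis // => /eqP; rewrite scaler_eq0 (negPf g0) => /eqP.
- apply/eqP; rewrite eqn_leq; apply/andP; split.
    by apply: (leq_trans (mxrank_adds_leqif _ _)); rewrite !rank_rV; do 2!case: (_ != 0).
  suff : (pt p c < axis)%MS.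
    rewrite ltmxErank => /andP[_]; rewrite rank_rV.
    suff -> : pt p c != 0 by [].
    by apply/eqP => /rowP/(_ 2); rewrite !mxE.
  rewrite /ltmx addsmxSl /=; apply/negP => /(submx_trans (addsmxSr _ _)).
  move=> /sub_rVP[a /rowP E].
  have := E 2; have := E 1; rewrite !mxE /= mulr1 => E1 E2; move: E1.
  by rewrite -E2 mul0r => /eqP; rewrite oner_eq0.
- exists C; split=> //.
    by apply/negP => /axisP /eqP; rewrite (negPf k0).
  move=> P P0; apply/idP/orP => [/(pt_eqP _ _ P0)[a a0 E]|[/axisP E|/(pt_eqP _ _ C0)[a a0 E]]].
  + have := tact P; rewrite E; set t := P 0 0 - p * P 0 2.
    rewrite !mxE (_ : _ - _ = a * t) /t; last by ring.
    rewrite -/t => /eqP; rewrite -subr_eq0 -mulrBl mulf_eq0 => /orP[ak|/eqP t0];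
      last by left; apply/axisP.
    case: (eqVneq t 0) => [t0|t0]; [by left; apply/axisP|right].
    apply/(pt_eqP _ _ C0); exists (t / k); first by rewrite mulf_neq0 ?invr_eq0.
    move: E; rewrite act -/t; move/eqP: ak => /(canRL (subrK _)); rewrite add0r => ->.
    rewrite (scalerDl P) => /addrI E.
    by rewrite mulrC -scalerA E scalerA mulVf ?scale1r.
  + by apply/(pt_eqP _ _ P0); exists g; rewrite ?Maxis.
  + apply/(pt_eqP _ _ P0); exists (g + k) => //.
    have -> : P *m M = g *: P + (a * k) *: C.
      by rewrite act; congr (_ + _ *: _); rewrite E !mxE /k; ring.
    by rewrite scalerDl {3}E scalerA (mulrC k).
Qed.

(** The centre of the homology, scaled so that t takes the value h (d - d') there,
    which is the difference of the eigenvalues h d and h d'. *)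
Definition hcentre F m n : 'rV[rat]_3 :=
  \row_(j < 3) [:: gap F * (opening m - opening n) + vx F * skew m n;
                   shear F m n; skew m n]`_j.

Definition hom_mx F m n : 'M[rat]_3 :=
  (gap F * opening n)%:M + axis_form (vx F) *m hcentre F m n.

Lemma hom_mx_act F m n (v : 'rV[rat]_3) :
  v *m hom_mx F m n =
  (gap F * opening n) *: v + (v 0 0 - vx F * v 0 2) *: hcentre F m n.
Proof.
by rewrite mulmxDr mul_mx_scalar mulmxA mul_axis_form mul_scalar_mx.
Qed.

Lemma hom_mx_homology F m n : gap F != 0 -> opening m != 0 -> opening n != 0 ->
  opening m != opening n ->
  homology (hom_mx F m n) (join (pt (vx F) (vy F)) o_infty).
Proof.
move=> h0 dm dn dmn.
have kE : hcentre F m n 0 0 - vx F * hcentre F m n 0 2 = gap F * (opening m - opening n).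
  by rewrite !mxE /=; ring.
apply: rank1_homology; rewrite ?kE.
- by rewrite mulf_neq0.
- by rewrite mulf_neq0 // subr_eq0.
- by rewrite -mulrDr addrC subrK mulf_neq0.
Qed.

Lemma skewC m n : skew n m = - skew m n.
Proof. by rewrite /skew; ring. Qed.

Lemma shearC F m n : shear F n m = - shear F m n.
Proof. by rewrite /shear skewC; ring. Qed.

(** Exchanging the two sides exchanges the eigenvalues and negates the centre. *)
Lemma hom_mx_swap F m n :
  hom_mx F n m *m hom_mx F m n = (gap F ^+ 2 * opening m * opening n)%:M.
Proof.
apply/row_matrixP => i; rewrite !rowE mulmxA; set v := delta_mx _ _.
rewrite mul_mx_scalar !hom_mx_act; apply: row3P;
  rewrite !mxE /= ?(skewC m n) ?(shearC F m n); ring.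
Qed.

(** The hypothesis is the condition that the image of the point at infinity of
    the first line lies on the second one; the two lines meet on the axis. *)
Lemma hom_mx_line F m n c s s' :
  c * skew m n + gap F * (s' * opening m - opening n * s) = shear F m n ->
  (graph_line (line (vx F) c s) *m hom_mx F m n <=
   graph_line (line (vx F) c s'))%MS.
Proof.
move=> E; rewrite /graph_line /join addsmxMr addsmx_sub -/(join _ _).
by apply/andP; split; apply/graph_lineP; rewrite hom_mx_act !mxE /= -E !horner_line; ring.
Qed.

(** The converse inclusion is the inclusion for the inverse homology. *)
Lemma hom_mx_maps_line F m n c s s' :
  gap F != 0 -> opening m != 0 -> opening n != 0 ->
  c * skew m n + gap F * (s' * opening m - opening n * s) = shear F m n ->
  (graph_line (line (vx F) c s) *m hom_mx F m n ==
   graph_line (line (vx F) c s'))%MS.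
Proof.
move=> h0 dm dn E; rewrite hom_mx_line //=.
have E' : c * skew n m + gap F * (s * opening n - opening m * s') = shear F n m.
  by rewrite (skewC m n) (shearC F m n) -E; ring.
have := submxMr (hom_mx F m n) (hom_mx_line _ _ _ _ _ _ E').
rewrite -mulmxA hom_mx_swap mul_mx_scalar.
by rewrite eqmx_scale // !mulf_neq0 // expf_neq0.
Qed.

Lemma hom_mx_determined F m n :
  gap F != 0 -> opening m != 0 -> opening n != 0 ->
  [/\ (graph_line (lineI F m) *m hom_mx F m n == graph_line (lineI F n))%MS,
      (graph_line (lineJ F m) *m hom_mx F m n == graph_line (lineJ F n))%MS &
      (graph_line (lineK F m) *m hom_mx F m n == graph_line (lineK F n))%MS].
Proof.
by move=> h0 dm dn; split; apply: hom_mx_maps_line => //;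
  rewrite /shear /skew /opening; ring.
Qed.

(** A collineation that fixes every point of the axis is scalar on it, say with
    factor g, so it is given by g and by the image of one point off the axis. The
    images of the three lines are three linear equations that determine this image
    from g. *)
Lemma hom_mx_unique F m n (M : 'M[rat]_3) :
  gap F != 0 -> opening m != 0 -> opening n != 0 ->
  homology M (join (pt (vx F) (vy F)) o_infty) ->
  (graph_line (lineI F m) *m M <= graph_line (lineI F n))%MS ->
  (graph_line (lineJ F m) *m M <= graph_line (lineJ F n))%MS ->
  (graph_line (lineK F m) *m M <= graph_line (lineK F n))%MS ->
  proportional M (hom_mx F m n).
Proof.
case: F => p c h; rewrite /lineI /lineJ /lineK /= => h0 dm dn [Mu _ [C [_ _ fixM]]] MI MJ MK.
have scal (v : 'rV[rat]_3) : v != 0 -> v 0 0 - p * v 0 2 = 0 ->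
    exists2 k, k != 0 & v *m M = k *: v.
  move=> v0 E; apply/pt_eqP => //; rewrite fixM //.
  by apply/orP; left; apply/axisP.
set v := pt p c.
have o0 : o_infty != 0 by apply/eqP => /rowP/(_ 1); rewrite !mxE => /eqP.
have v0 : v != 0 by apply/eqP => /rowP/(_ 2); rewrite !mxE => /eqP.
have ov0 : o_infty + v != 0.
  by apply/eqP => /rowP/(_ 2); rewrite !mxE /= add0r => /eqP.
have [|g g0 Eo] := scal _ o0; first by rewrite !mxE /=; ring.
have [|g1 _ Ev] := scal _ v0; first by rewrite !mxE /=; ring.
have [|g2 _ Eov] := scal _ ov0; first by rewrite !mxE /=; ring.
(* The sum of two fixed points of the axis is fixed too, so they have the same
   eigenvalue. *)
have {}Ev : v *m M = g *: v.
  have /rowP E : g *: o_infty + g1 *: v = g2 *: (o_infty + v).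
    by rewrite -Eo -Ev -Eov mulmxDl.
  move: (E 1) (E 2); rewrite !mxE /= => E1 E2; rewrite Ev; congr (_ *: _).
  have e12 : g1 = g2 by move: E2; rewrite !mulr0 !add0r !mulr1.
  by move: E1; rewrite e12 mulrDr !mulr1 => /addIr ->.
pose e : 'rV[rat]_3 := \row_(j < 3) [:: 1; 0; 0]`_j.
pose u := e *m M.
have dir b s s' :
    (graph_line (line p b s) *m M <= graph_line (line p b s'))%MS ->
    u 0 1 + s * g = b * u 0 2 + s' * (u 0 0 - p * u 0 2).
  (* the point at infinity of a line of slope s *)
  move=> sub; pose q := e + s *: o_infty.
  have ql : (q <= graph_line (line p b s))%MS.
    by apply/graph_lineP; rewrite !mxE /=; ring.
  have /graph_lineP := submx_trans (submxMr M ql) sub.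
  by rewrite mulmxDl -scalemxAl Eo -/u !mxE /= mulr1 !mulr0 !addr0.
move/dir: MI; move/dir: MJ; move/dir: MK.
set x := u 0 0; set y := u 0 1; set z := u 0 2 => EK EJ EI.
have h0' : h * opening n != 0 by rewrite mulf_neq0.
pose k := g / (h * opening n).
exists k; first by rewrite mulf_neq0 // invr_eq0.
have Eg : g = k * (h * opening n) by rewrite /k divfK.
have Ex : x = k * h * opening m + p * z.
  apply: (mulIf dn); move: EI EJ; rewrite Eg /opening; nra.
have Ez : z = k * skew m n.
  apply: (mulfI h0); rewrite /skew.
  move: EI EJ EK; rewrite Ex Eg /opening; nra.
have Ey : y = k * shear (Frame p c h) m n.
  by move: EI; rewrite Ex Ez Eg /shear /skew /opening /=; nra.
have Eu : u = k *: (e *m hom_mx (Frame p c h) m n).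
  apply: row3P; [rewrite -/x Ex Ez | rewrite -/y Ey | rewrite -/z Ez];
    by rewrite hom_mx_act !mxE /=; ring.
have gen (w : 'rV[rat]_3) :
    w = (w 0 0 - p * w 0 2) *: e + (w 0 1 - c * w 0 2) *: o_infty + w 0 2 *: v.
  by apply: row3P; rewrite !mxE /=; ring.
apply/row_matrixP => i; rewrite !rowE; set w := delta_mx _ _.
rewrite -scalemxAr (gen w) !mulmxDl -!scalemxAl -/u Eu Eo Ev Eg !hom_mx_act.
apply: row3P; rewrite !mxE /=; ring.
Qed.

(** Dividing the image of (x, z, 1) by its last coordinate gives mu(x) and f(z). *)
Lemma hom_mx_induces F m n : gap F != 0 -> opening m != 0 -> opening n != 0 ->
  induces (hom_mx F m n) (std_of F m n).
Proof.
move=> h0 dm dn x z a b.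
rewrite std_mob_den // => D0 /(std_f_value _ _ _ _ _ _ _ h0 dn D0)[-> ->].
rewrite std_mob //; move: D0; set D := evalq _ _ => D0; rewrite !ratr_rat.
have ED : D = gap F * opening n + skew m n * (x - vx F).
  by rewrite /D evalq_line !ratr_rat.
have -> : pt x z *m hom_mx F m n = D *: pt
    (vx F + gap F * opening m * (x - vx F) / D)
    (gap F * opening n / D * z + shear F m n * (x - vx F) / D).
  by apply: row3P; rewrite hom_mx_act !mxE /= ?ED; field; rewrite -?ED.
by apply/eqmxP; apply: eqmx_scale.
Qed.

(** * Identities that hold on one side of a point *)

(** Infinitely many points are needed to recognise polynomials from their values.
    A side of [p] is given by a number [e], whose sign alone matters. *)
Lemma side_points (R : realType) (p e : R) (P : R -> Prop) : e != 0 ->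
  (\forall x \near p, 0 < e * (x - p) -> P x) ->
  exists2 u : nat -> R, injective u & forall n, P (u n).
Proof.
move=> e0 /nbhs_ballP[r /= r0 H].
pose u (k : nat) : R := p + Num.sg e * (r / k.+2%:R).
have s0 : Num.sg e != 0 by rewrite sgr_eq0.
exists u => [i j /addrI /(mulfI s0) /(mulfI (lt0r_neq0 r0)) /invr_inj /eqP|k].
  by rewrite eqr_nat => /eqP[].
have d0 : 0 < r / k.+2%:R by rewrite divr_gt0.
apply: H.
  rewrite /ball /= /u opprD addrA subrr sub0r normrN normrM normr_sg e0 mul1r.
  by rewrite gtr0_norm // ltr_pdivrMr // ltr_pMr // ltr1n.
by rewrite /u addrC addKr mulrA (mulrC e) -normrEsg mulr_gt0 ?normr_gt0.
Qed.

Lemma evalq_eq0_side (R : realType) (p e : R) (q : {poly rat}) : e != 0 ->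
  (\forall x \near p, 0 < e * (x - p) -> evalq q x = 0) -> q = 0.
Proof.
move=> e0 /(side_points _ _ _ _ e0)[u uI u0].
have [->//|q0] := eqVneq q 0; pose k := (size q).
have := @max_poly_roots _ (map_poly (ratr : rat -> R) q) [seq u i | i <- iota 0 k].
rewrite map_poly_eq0 q0 size_map size_iota size_map_poly ltnn => /(_ isT) F.
suff : false by []; apply: F.
  by apply/allP => _ /mapP[i _ ->]; apply/eqP; exact: u0.
by rewrite map_inj_uniq ?iota_uniq.
Qed.

Lemma rf_eq_side (R : realType) (p e : R) (phi psi : ratfun) : e != 0 ->
  (\forall x \near p, 0 < e * (x - p) ->
     exists2 v : R, rf_value phi x v & rf_value psi x v) -> phi = psi.
Proof.
move=> e0 H; have [u _ /(_ 0%N)] := side_points _ _ _ _ e0 H.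
move=> [_ [n [d [phiE dx _]]] [n' [d' [psiE dx' _]]]].
have nz q (x : R) : evalq q x != 0 -> q != 0.
  by apply: contraNneq => ->; rewrite /evalq rmorph0 hornerE.
have d0 := nz _ _ dx; have d0' := nz _ _ dx'.
rewrite phiE psiE; apply/eqP; rewrite eqr_div ?rf_eq0 // -!rfM; apply/eqP; congr rf.
apply/eqP; rewrite -subr_eq0; apply/eqP; apply: (evalq_eq0_side _ p e _ e0).
near=> x => ex; have [v] : exists2 v : R, rf_value phi x v & rf_value psi x v.
  by move: ex; near: x.
rewrite phiE psiE => /(rf_value_eq _ _ _ _ _ d0) E /(rf_value_eq _ _ _ _ _ d0') E'.
by rewrite evalqB !evalqM -E -E' mulrAC subrr.
Unshelve. all: by end_near. Qed.

Definition mob_num {F : numFieldType} (M : 'M[rat]_2) (x : F) : F :=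
  ratr (M 0 0) * x + ratr (M 0 1).

(** The hypotheses say that the coefficients of the polynomial identity behind P = Q, as
    Moebius transformations, agree. *)
Lemma adj_mul2 (P Q : 'M[rat]_2) (s : rat) :
  P 0 1 * Q 1 1 = Q 0 1 * P 1 1 -> P 0 0 * Q 1 0 = Q 0 0 * P 1 0 ->
  Q 1 1 * P 0 0 - Q 0 1 * P 1 0 = s -> Q 0 0 * P 1 1 - Q 1 0 * P 0 1 = s ->
  \adj Q *m P = s%:M.
Proof.
move=> e0 e2 e1 e1'; apply/matrixP => i j.
rewrite !mxE !big_ord_recl big_ord0 !mxE /cofactor !det_mx11 !mxE.
have E : forall k : 'I_2, k = 0 \/ k = 1.
  by move=> [[|[|//]] ik]; [left|right]; apply: val_inj.
have l0 : lift 0 0 = 1 :> 'I_2 by apply: val_inj.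
have l1 : lift 1 0 = 0 :> 'I_2 by apply: val_inj.
case: (E i) => ->; case: (E j) => ->; rewrite ?l0 ?l1 /=;
  rewrite -?e1 -?e1'; lra.
Qed.

(** Equality of the quotients is an identity between quadratic polynomials; its
    three coefficients say that the adjugate of [Q] times [P] is scalar. *)
Lemma mob_eq_side (R : realType) (p e : R) (P Q : 'M[rat]_2) : e != 0 ->
  P \in unitmx -> Q \in unitmx ->
  (\forall x \near p, 0 < e * (x - p) ->
     mob_num P x * mob_den Q x = mob_num Q x * mob_den P x) ->
  proportional P Q.
Proof.
move=> e0 Pu Qu H.
pose L (a b : rat) : {poly rat} := a *: 'X + b%:P.
have LE a b (x : R) : evalq (L a b) x = ratr a * x + ratr b.
  by rewrite /evalq rmorphD /= map_polyZ /= map_polyX map_polyC /= !hornerE.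
have E : L (P 0 0) (P 0 1) * L (Q 1 0) (Q 1 1) -
         L (Q 0 0) (Q 0 1) * L (P 1 0) (P 1 1) = 0.
  apply: (evalq_eq0_side _ p e _ e0); near=> x => ex.
  rewrite evalqB !evalqM !LE; apply/eqP; rewrite subr_eq0; apply/eqP.
  by move: ex; near: x.
have ev t := congr1 (horner^~ t) E.
move: (ev 0) (ev 1) (ev (- 1)); rewrite /L !hornerE => E0 E1 E2.
have M := adj_mul2 P Q (Q 1 1 * P 0 0 - Q 0 1 * P 1 0).
have {}M : \adj Q *m P = (Q 1 1 * P 0 0 - Q 0 1 * P 1 0)%:M by apply: M; nra.
set s := (_ - _) in M.
have dQ : \det Q != 0 by rewrite -unitfE -unitmxE.
have PE : \det Q *: P = s *: Q.
  by rewrite -mul_scalar_mx -mul_mx_adj -mulmxA M mul_mx_scalar.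
exists (s / \det Q); last by rewrite mulrC -scalerA -PE scalerA mulVf ?scale1r.
rewrite mulf_neq0 ?invr_eq0 //; apply/eqP => s0.
move: PE; rewrite s0 scale0r => /eqP; rewrite scaler_eq0 (negPf dQ) /= => /eqP P0.
by move: Pu; rewrite P0 unitmxE det0 unitr0.
Unshelve. all: by end_near. Qed.

(** * Behaviour close to the X-point *)

Lemma cvg_affine (R : realType) (a b p : R) :
  (fun x : R => a * x + b) @ p --> a * p + b.
Proof. by apply: cvgD; [apply: cvgM; [exact: cvg_cst|exact: cvg_id]|exact: cvg_cst]. Qed.

Lemma cvg_evalq_line (R : realType) q c s (p : R) :
  (fun x : R => evalq (line q c s) x) @ p --> evalq (line q c s) p.
Proof.
have E (x : R) : evalq (line q c s) x = ratr s * x + (ratr c - ratr s * ratr q).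
  by rewrite evalq_line; ring.
by under eq_fun do rewrite E; rewrite E; exact: cvg_affine.
Qed.

Lemma cvg_mob (R : realType) M (p : R) : mob_den M p != 0 ->
  mob M x @[x --> p] --> mob M p.
Proof.
by move=> d0; apply: cvgM; [exact: cvg_affine|apply: cvgV => //; exact: cvg_affine].
Qed.

Lemma near_line_gt0 (R : realType) p c s : 0 < c ->
  \forall x \near (ratr p : R), 0 < evalq (line p c s) x.
Proof.
move=> c0; apply: (cvgr_gt _ (cvg_evalq_line R p c s (ratr p))).
by rewrite evalq_line subrr mulr0 addr0 ltr0q.
Qed.

Lemma near_line_neq0 (R : realType) p c s : c != 0 ->
  \forall x \near (ratr p : R), evalq (line p c s) x != 0.
Proof.
move=> c0; apply: (cvgr_neq0 _ (cvg_evalq_line R p c s (ratr p))).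
by rewrite evalq_line subrr mulr0 addr0 fmorph_eq0.
Qed.

(** Close to the X-point, I - J is small while K - I is close to the gap. *)
Lemma near_order (R : realType) G m : 0 < gap G ->
  \forall x \near (ratr (vx G) : R),
    [/\ evalq (lineI G m) x < evalq (lineK G m) x,
        evalq (lineI G m) x - evalq (lineJ G m) x < evalq (lineK G m) x - evalq (lineI G m) x &
        evalq (lineI G m) x - evalq (lineJ G m) x = ratr (opening m) * (x - ratr (vx G))].
Proof.
move=> h0; near=> x.
have A : 0 < evalq (line (vx G) (gap G) (slopeK m - slopeI m)) x by near: x; exact: near_line_gt0.
(* (K - I) - (I - J), whose value at the X-point is the gap *)
have C : 0 < evalq (line (vx G) (gap G) (slopeK m - slopeI m - (slopeI m - slopeJ m))) x.
  by near: x; exact: near_line_gt0.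
move: A C; rewrite /opening /lineI /lineJ /lineK !evalq_line.
rewrite !(rmorphB, rmorphD) /=; split; lra.
Unshelve. all: by end_near. Qed.

(** * Matching the branches *)

(** An increasing affine map matches the triples in order. A decreasing one would
    send the short interval from j to i to the long interval from i' to k'. *)
Lemma affine_match (R : realFieldType) (a b i j k i' j' k' : R) : a != 0 ->
  j < i -> i < k -> i - j < k - i -> j' < i' -> i' < k' -> i' - j' < k' - i' ->
  perm_eq [:: a * i + b; a * j + b; a * k + b] [:: i'; j'; k'] ->
  [/\ a * i + b = i', a * j + b = j' & a * k + b = k'].
Proof.
move=> a0 ji ik short ji' ik' short' /perm_mem E.
have st' : sorted <%R [:: j'; i'; k'] by rewrite /= ji' ik'.
have mem' : [:: j'; i'; k'] =i [:: a * i + b; a * j + b; a * k + b].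
  by move=> z; rewrite E !inE orbCA.
move: a0; rewrite neq_lt => /orP[] sa.
- have st : sorted <%R [:: a * k + b; a * i + b; a * j + b].
    by rewrite /= andbT; apply/andP; split; nra.
  have [] : [:: j'; i'; k'] = [:: a * k + b; a * i + b; a * j + b].
    apply: lt_sorted_eq => // z; rewrite mem' !inE.
    by rewrite orbA orbC.
  by move=> ej ei ek; exfalso; nra.
- have st : sorted <%R [:: a * j + b; a * i + b; a * k + b].
    by rewrite /= andbT; apply/andP; split; nra.
  have [] : [:: j'; i'; k'] = [:: a * j + b; a * i + b; a * k + b].
    by apply: lt_sorted_eq => // z; rewrite mem' !inE orbCA.
  by move=> -> -> ->.
Qed.

(** Composition with a Moebius transformation, without its denominator; this is
    the product of matrices. *)
Lemma evalq_line_mob (F : numFieldType) p c s M (x : F) : mob_den M x != 0 ->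
  evalq (line p c s) (mob M x) * mob_den M x =
  ratr s * mob_num M x + ratr (c - s * p) * mob_den M x.
Proof.
move=> D0; have -> : mob_num M x = mob M x * mob_den M x by rewrite /mob divfK.
by rewrite evalq_line rmorphB rmorphM /=; ring.
Qed.

(** The quotient (K - I) / (K - J) is unchanged when the same affine map is applied
    to I, J and K. Hence mu carries this quotient for [m] to the quotient for [n],
    and both are Moebius transformations of x, which determines mu. Then f is
    known from the images of two distinct values. *)
Lemma matched_pair (R : realType) (e : R) G m n (E : mpair) :
  0 < gap G -> opening m != 0 -> opening n != 0 -> e != 0 ->
  mp_mu E \in unitmx ->
  (\forall x \near (ratr (vx G) : R), 0 < e * (x - ratr (vx G)) ->
     mob_den (mp_mu E) x != 0 /\ exists a b : R, let y := mob (mp_mu E) x in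
     [/\ f_value E x a b, a != 0,
         a * evalq (lineI G m) x + b = evalq (lineI G n) y,
         a * evalq (lineJ G m) x + b = evalq (lineJ G n) y &
         a * evalq (lineK G m) x + b = evalq (lineK G n) y]) ->
  same_pair E (std_of G m n).
Proof.
move=> h0 dm dn e0 Eu H; have hn0 : gap G != 0 by rewrite lt0r_neq0.
set N := mob_quot (lineK G m - lineI G m) (lineK G m - lineJ G m).
set N' := mob_quot (lineK G n - lineI G n) (lineK G n - lineJ G n).
have Nu : N \in unitmx by exact: ratio_unit.
have Nu' : N' \in unitmx by exact: ratio_unit.
have muE : proportional (mp_mu E) (mp_mu (std_of G m n)).
  have [s s0 Es] : proportional (N' *m mp_mu E) N.
    apply: (mob_eq_side R (ratr (vx G)) e) => //; first by rewrite unitmx_mul Nu' Eu.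
    near=> x => ex.
    have [D0 [a [b [_ a0 eI eJ eK]]]] :
        mob_den (mp_mu E) x != 0 /\ exists a b : R, let y := mob (mp_mu E) x in
         [/\ f_value E x a b, a != 0,
         a * evalq (lineI G m) x + b = evalq (lineI G n) y,
         a * evalq (lineJ G m) x + b = evalq (lineJ G n) y &
         a * evalq (lineK G m) x + b = evalq (lineK G n) y] by move: ex; near: x.
    set y := mob (mp_mu E) x in eI eJ eK.
    have numN : mob_num N x = evalq (lineK G m) x - evalq (lineI G m) x.
      rewrite -evalqB /N KI_line KJ_line /mob_num !mxE /= coef1_line coef0_line.
      by rewrite evalq_line !(rmorphB, rmorphM) /=; ring.
    have denN : mob_den N x = evalq (lineK G m) x - evalq (lineJ G m) x.
      by rewrite -evalqB /N KI_line KJ_line mob_den_quot.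
    have numN' : mob_num (N' *m mp_mu E) x =
        (evalq (lineK G n) y - evalq (lineI G n) y) * mob_den (mp_mu E) x.
      rewrite -evalqB /N' KI_line KJ_line evalq_line_mob // /mob_num /mob_den.
      rewrite !mxE !big_ord_recl !big_ord0 !mxE /= coef1_line coef0_line.
      have -> : lift ord0 ord0 = 1 :> 'I_2 by apply: val_inj.
      by rewrite !(rmorphD, rmorphB, rmorphM, rmorph0) /=; ring.
    have denN' : mob_den (N' *m mp_mu E) x =
        (evalq (lineK G n) y - evalq (lineJ G n) y) * mob_den (mp_mu E) x.
      rewrite -evalqB /N' KI_line KJ_line evalq_line_mob // /mob_num /mob_den.
      rewrite !mxE !big_ord_recl !big_ord0 !mxE /= coef1_line coef0_line.
      have -> : lift ord0 ord0 = 1 :> 'I_2 by apply: val_inj.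
      by rewrite !(rmorphD, rmorphB, rmorphM, rmorph0) /=; ring.
    rewrite numN denN numN' denN' -eI -eJ -eK; ring.
  exists s => //; rewrite /= /std_mu -/N -/N' scalemxAr -Es mulmxA mulVmx //.
  by rewrite mul1mx.
have [s s0 Es] := muE.
have AB : \forall x \near (ratr (vx G) : R), 0 < e * (x - ratr (vx G)) ->
    exists a b : R, f_value E x a b /\ f_value (std_of G m n) x a b.
  near=> x => ex.
  have D0 : evalq (mu_den G m n) x != 0.
    by near: x; apply: near_line_neq0; rewrite mulf_neq0.
  have [_ [a [b [fE _ eI eJ eK]]]] :
        mob_den (mp_mu E) x != 0 /\ exists a b : R, let y := mob (mp_mu E) x in
         [/\ f_value E x a b, a != 0,
         a * evalq (lineI G m) x + b = evalq (lineI G n) y,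
         a * evalq (lineJ G m) x + b = evalq (lineJ G n) y &
         a * evalq (lineK G m) x + b = evalq (lineK G n) y] by move: ex; near: x.
  have IK : evalq (lineI G m) x < evalq (lineK G m) x.
    by near: x; apply: filterS (near_order R G m h0) => ? [].
  exists a, b; split => //.
  pose a0 : R := ratr (gap G * opening n) / evalq (mu_den G m n) x.
  pose b0 : R := ratr (shear G m n) * (x - ratr (vx G)) / evalq (mu_den G m n) x.
  have f0 : f_value (std_of G m n) x a0 b0 by apply/std_f_value.
  have [] := std_maps_branches R G m n x hn0 dn D0 a0 b0 f0.
  move: eI eJ eK; rewrite Es mobZ // => <- _ <- e1 _ e2.
  have aa : a = a0.
    have KI0 : evalq (lineK G m) x - evalq (lineI G m) x != 0 by rewrite subr_eq0 gt_eqF.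
    by apply: (mulIf KI0); lra.
  have -> : b = b0 by rewrite -aa in e1; exact: (addrI _ (esym e1)).
  by rewrite aa.
split=> //; apply: (rf_eq_side R (ratr (vx G)) e) => //.
  by apply: filterS AB => x H' /H'[a [b [[? _] [? _]]]]; exists a.
by apply: filterS AB => x H' /H'[a [b [[_ ?] [_ ?]]]]; exists b.
Unshelve. all: by end_near. Qed.

(** * Self-equivalence and inverse *)

(** The side of the X-point where J <= I for the slopes [m]; it contains the
    X-point, which the two sides have in common. *)
Definition side (R : realType) G m (x : R) : bool :=
  0 <= ratr (opening m) * (x - ratr (vx G)).
Arguments side {R}.

Definition branch (R : realType) (Om : R -> seq R) G m : Prop :=
  \forall x \near (ratr (vx G) : R), side G m x ->
    perm_eq (Om x) [:: evalq (lineI G m) x; evalq (lineJ G m) x; evalq (lineK G m) x].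
Arguments branch {R}.

(** With d and d' the openings, d' (mu(x) - p) = h (d t) d' / (h d' + w t), and the
    denominator has the sign of d' close to p. *)
Lemma near_std_side (R : realType) G m n : 0 < gap G -> opening n != 0 ->
  \forall x \near (ratr (vx G) : R), evalq (mu_den G m n) x != 0 /\
    (side G m x -> side G n (mob (mp_mu (std_of G m n)) x)).
Proof.
move=> h0 dn; have hn0 := lt0r_neq0 h0; near=> x.
have D0 : evalq (mu_den G m n) x != 0.
  by near: x; apply: near_line_neq0; rewrite mulf_neq0.
have P : 0 < evalq (line (vx G) (opening n * (gap G * opening n))
                      (opening n * skew m n)) x.
  near: x; apply: near_line_gt0; rewrite mulrCA mulr_gt0 //.
  by rewrite -expr2 exprn_even_gt0.
split=> //; rewrite /side std_mob // (addrC (ratr (vx G))) addrK => s.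
have {}P : 0 < ratr (opening n) * evalq (mu_den G m n) x.
  move: P; rewrite /mu_den !evalq_line !(rmorphM ratr (opening n)) /=.
  move=> P; lra.
set D := evalq _ _ in D0 P *.
have -> : ratr (opening n) * (ratr (gap G * opening m) * (x - ratr (vx G)) / D) =
   ratr (gap G) * (ratr (opening m) * (x - ratr (vx G))) * (ratr (opening n) * D) / D ^+ 2.
  by rewrite (rmorphM ratr (gap G)) /=; field.
rewrite divr_ge0 ?sqr_ge0 // mulr_ge0 ?(ltW P) // mulr_ge0 // ler0q; exact: ltW.
Unshelve. all: by end_near. Qed.

Lemma std_fixes (R : realType) G m n : gap G != 0 -> opening n != 0 ->
  mob_den (mp_mu (std_of G m n)) (ratr (vx G) : R) != 0 /\
  mob (mp_mu (std_of G m n)) (ratr (vx G) : R) = ratr (vx G).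
Proof.
move=> h0 dn; have D0 : evalq (mu_den G m n) (ratr (vx G) : R) != 0.
  by rewrite evalq_line subrr mulr0 addr0 fmorph_eq0 mulf_neq0.
by rewrite std_mob_den // std_mob // subrr mulr0 mul0r addr0.
Qed.

Lemma near_mob (R : realType) M (p : R) (P : R -> Prop) :
  mob_den M p != 0 -> mob M p = p ->
  (\forall x \near p, P x) -> \forall x \near p, P (mob M x).
Proof. by move=> D0 Mp; have := cvg_mob R M p D0; rewrite Mp => c /c. Qed.

Lemma std_self_equivalence (R : realType) (Om : R -> seq R) (S : pred R) G m n :
  0 < gap G -> opening m != 0 -> opening n != 0 ->
  (forall x, S x -> side G m x) -> branch Om G m -> branch Om G n ->
  self_equivalence (vx G) S Om (std_of G m n).
Proof.
move=> h0 dm dn Sm bm bn; have hn0 := lt0r_neq0 h0.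
have [Dp Mp] := std_fixes R G m n hn0 dn.
split=> //; first exact: std_mu_unit.
have bn' := near_mob R _ _ _ Dp Mp bn.
apply: filterS3 (near_std_side R G m n h0 dn) bm bn'.
move=> x [D0 sn] Omx Omy /Sm sx; split; first by rewrite std_mob_den.
pose a : R := ratr (gap G * opening n) / evalq (mu_den G m n) x.
pose b : R := ratr (shear G m n) * (x - ratr (vx G)) / evalq (mu_den G m n) x.
have fE : f_value (std_of G m n) x a b by apply/std_f_value.
exists a, b; split=> //.
  by rewrite mulf_neq0 ?invr_eq0 ?fmorph_eq0 ?mulf_neq0.
have [eI eJ eK] := std_maps_branches R G m n x hn0 dn D0 a b fE.
apply: (perm_trans (perm_map _ (Omx sx))); rewrite /= eI eJ eK perm_sym.
exact: (Omy (sn sx)).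
Qed.

(** Exchanging the sides negates w and the translation coefficient, and the
    denominators of mu and of its inverse are related by D'(mu(x)) D(x) = h^2 d d'. *)
Lemma std_inverse (R : realType) G m n :
  0 < gap G -> opening m != 0 -> opening n != 0 ->
  inverse_pair R (vx G) (std_of G m n) (std_of G n m).
Proof.
move=> h0 dm dn; have hn0 := lt0r_neq0 h0.
split.
  exists 1; rewrite ?oner_eq0 // scale1r /= /std_mu.
  set N := mob_quot _ _; set N' := mob_quot _ _.
  have Nu : N \in unitmx by exact: ratio_unit.
  have Nu' : N' \in unitmx by exact: ratio_unit.
  have Mu : invmx N' *m N \in unitmx by rewrite unitmx_mul unitmx_inv Nu Nu'.
  rewrite -[LHS]mul1mx -(mulVmx Mu) -!mulmxA (mulmxA N) mulmxV // mul1mx.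
  by rewrite mulVmx // mulmx1.
apply: filterS (near_std_side R G m n h0 dn) => x [D0 _].
rewrite std_mob_den //; split=> //.
set y := mob _ _; set t := x - ratr (vx G).
have yE : y - ratr (vx G) = ratr (gap G * opening m) * t / evalq (mu_den G m n) x.
  by rewrite /y std_mob // (addrC (ratr (vx G))) addrK.
have DE : evalq (mu_den G n m) y * evalq (mu_den G m n) x =
    ratr (gap G * opening m) * ratr (gap G * opening n).
  rewrite [evalq (mu_den G n m) y]evalq_line yE (skewC m n) rmorphN /=.
  rewrite mulrDl mulNr mulNr mulrA divfK // evalq_line -/t; ring.
have D0' : evalq (mu_den G n m) y != 0.
  apply: contra_neq (_ : ratr (gap G * opening m) * ratr (gap G * opening n) != 0 :> R).
    by move=> D0'; rewrite -DE D0' mul0r.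
  by rewrite mulf_neq0 // fmorph_eq0 mulf_neq0.
eexists _, _, _, _; split.
- by apply/std_f_value.
- by apply/std_f_value.
- move=> z; rewrite yE (shearC G m n) rmorphN /= -/t.
  have -> : evalq (mu_den G n m) y =
     ratr (gap G * opening m) * ratr (gap G * opening n) / evalq (mu_den G m n) x.
    by rewrite -DE mulfK.
  have A : ratr (gap G * opening m) != 0 :> R by rewrite fmorph_eq0 mulf_neq0.
  have B : ratr (gap G * opening n) != 0 :> R by rewrite fmorph_eq0 mulf_neq0.
  move: A B D0; move: (ratr (gap G * opening m)) (ratr (gap G * opening n)) => A B.
  by move: (evalq _ _) => D A0 B0 D0; field; rewrite A0 B0 D0.
Qed.

(** * Trivial and non-trivial pairs *)

Lemma proportional_trans k l (A B C : 'M[rat]_(k, l)) :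
  proportional A B -> proportional B C -> proportional A C.
Proof.
by move=> [c c0 ->] [d d0 ->]; exists (c * d); rewrite ?mulf_neq0 ?scalerA.
Qed.

(** A side matched with itself: w and the translation coefficient vanish. *)
Lemma std_diag_trivial G m : gap G != 0 -> opening m != 0 ->
  same_pair (std_of G m m) trivial_pair.
Proof.
move=> h0 dm; have [eA eB] := std_coeffs G m m h0 dm.
have D0 := mu_den_neq0 G m m h0 dm; rewrite -rf_eq0 in D0.
have sk : skew m m = 0 by rewrite /skew subrr.
have sh : shear G m m = 0 by rewrite /shear sk; ring.
split.
- by exists 1; rewrite ?oner_eq0 //= /std_mu mulVmx ?scale1r // ratio_unit.
- rewrite eA; have -> : (gap G * opening m)%:P = mu_den G m m.
    by rewrite /mu_den sk /line scale0r addr0.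
  exact: divff.
- by rewrite eB sh /line scale0r addr0 -/(rfC 0) rmorph0 mul0r.
Qed.

(** The derivative of mu at p is d / d', which is negative. *)
Lemma std_nontrivial G m n : gap G != 0 -> opening m * opening n < 0 ->
  ~ same_pair (std_of G m n) trivial_pair.
Proof.
move=> h0 dmn [[k k0]] /= + _ _.
have dn : opening n != 0 by apply: contraTneq dmn => ->; rewrite mulr0 ltxx.
have := std_muE G m n h0 dn; rewrite /= => -> E.
have s0 : (gap G * opening n)^-1 != 0 by rewrite invr_eq0 mulf_neq0.
have := congr1 (fun M : 'M[rat]_2 => M 1 0) E; have := congr1 (fun M : 'M[rat]_2 => M 0 0) E.
have := congr1 (fun M : 'M[rat]_2 => M 1 1) E.
rewrite !mxE /= !coef1_line !coef0_line mulr0 => <- /(mulfI s0) e.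
move/eqP; rewrite mulf_eq0 (negPf s0) /= => /eqP w0.
move: e; rewrite w0 mulr0 add0r mul0r subr0 => /(mulfI h0) e.
by move: dmn; rewrite e -expr2 ltNge sqr_ge0.
Qed.

(** * Uniqueness *)

Lemma mob_shift (F : numFieldType) M (p x : F) :
  mob_den M p != 0 -> mob_den M x != 0 -> mob M p = p ->
  mob M x - p = (ratr (M 0 0) - p * ratr (M 1 0)) * (x - p) / mob_den M x.
Proof.
move=> Dp Dx Mp.
have E : mob_num M p = p * mob_den M p by rewrite -{2}Mp /mob divfK.
apply: (mulIf Dx); rewrite divfK // mulrBl {1}/mob divfK //.
by move: E; rewrite /mob_num /mob_den => /(canRL (addKr _)) ->; ring.
Qed.

(** Up to a factor, this is the derivative of the transformation at the fixed
    point [p]. *)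
Lemma mob_shift_neq0 (F : numFieldType) (M : 'M[rat]_2) (p : rat) :
  M \in unitmx -> mob_den M (ratr p : F) != 0 -> mob M (ratr p : F) = ratr p ->
  ratr (M 0 0) - ratr p * ratr (M 1 0) != 0 :> F.
Proof.
move=> Mu Dp Mp.
have E : mob_num M (ratr p : F) = ratr p * mob_den M (ratr p : F) by rewrite -{2}Mp /mob divfK.
rewrite -rmorphM -rmorphB fmorph_eq0; apply: contraTneq Mu => /eqP.
rewrite subr_eq0 => /eqP e0.
have e1 : M 0 1 = p * M 1 1.
  apply: (fmorph_inj (ratr : rat -> F)); move: E.
  rewrite /mob_num /mob_den e0 !rmorphM /= => /(canRL (addKr _)) ->; ring.
rewrite unitmxE (expand_det_row _ 0) !big_ord_recl big_ord0 /cofactor !det_mx11 !mxE /=.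
have l1 : lift 0 0 = 1 :> 'I_2 by apply: val_inj.
have l0 : lift 1 0 = 0 :> 'I_2 by apply: val_inj.
rewrite ?l1 ?l0 e0 e1 (_ : _ + _ = 0) ?unitr0 //; ring.
Qed.

(** Once it is known to which side mu carries the side of [m], all values of the
    triad on both sides are known and the matching is forced. *)
Lemma self_equivalence_to_side (R : realType) (Om : R -> seq R) (S : pred R) G m l E :
  0 < gap G -> opening m != 0 -> opening l != 0 ->
  (forall x, 0 < ratr (opening m) * (x - ratr (vx G)) -> S x) ->
  branch Om G m -> branch Om G l ->
  self_equivalence (vx G) S Om E ->
  (\forall x \near (ratr (vx G) : R), 0 < ratr (opening m) * (x - ratr (vx G)) ->
     0 < ratr (opening l) * (mob (mp_mu E) x - ratr (vx G))) ->
  same_pair E (std_of G m l).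
Proof.
move=> h0 dm dl mS bm bl [Eu Dp Mp eqE] to_l.
have rm0 : ratr (opening m) != 0 :> R by rewrite fmorph_eq0.
apply: (matched_pair R (ratr (opening m))) => //.
have bl' := near_mob R _ _ _ Dp Mp bl.
have om := near_order R G m h0.
have ol := near_mob R _ _ _ Dp Mp (near_order R G l h0).
apply: filterS3 (filterI eqE to_l) (filterI bm bl') (filterI om ol).
move=> x [Ex lx] [bx by_] [ [IK short oi] [IK' short' oi']] mx.
have [D0 [a [b [fE a0 pE]]]] := Ex (mS x mx).
split=> //; exists a, b => /=.
have pm : perm_eq
    [seq a * z + b | z <- [:: evalq (lineI G m) x; evalq (lineJ G m) x;
                              evalq (lineK G m) x]]
    [:: evalq (lineI G l) (mob (mp_mu E) x); evalq (lineJ G l) (mob (mp_mu E) x);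
        evalq (lineK G l) (mob (mp_mu E) x)].
  apply: perm_trans (by_ (ltW (lx mx))); apply: perm_trans pE.
  by rewrite perm_sym; apply: perm_map; exact: bx (ltW mx).
have JI : evalq (lineJ G m) x < evalq (lineI G m) x by rewrite -subr_gt0 oi.
have JI' : evalq (lineJ G l) (mob (mp_mu E) x) < evalq (lineI G l) (mob (mp_mu E) x).
  by rewrite -subr_gt0 oi'; exact: lx.
have [eI eJ eK] := affine_match R a b _ _ _ _ _ _ a0 JI IK short JI' IK' short' pm.
by split.
Qed.

(** A Moebius transformation fixing p has a nonzero derivative there, so it preserves
    the sides of p or exchanges them. In the first case the pair is the one that
    matches a side with itself, which is trivial. *)
Lemma self_equivalence_unique (R : realType) (Om : R -> seq R) (S : pred R) G m n E :
  0 < gap G -> opening m * opening n < 0 ->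
  (forall x, 0 < ratr (opening m) * (x - ratr (vx G)) -> S x) ->
  branch Om G m -> branch Om G n ->
  self_equivalence (vx G) S Om E ->
  ~ same_pair E trivial_pair -> same_pair E (std_of G m n).
Proof.
move=> h0 dmn mS bm bn selfE Entriv.
have dm : opening m != 0 by apply: contraTneq dmn => ->; rewrite mul0r ltxx.
have dn : opening n != 0 by apply: contraTneq dmn => ->; rewrite mulr0 ltxx.
have [Eu Dp Mp _] := selfE.
set M := mp_mu E in Eu Dp Mp.
set d : R := ratr (M 0 0) - ratr (vx G) * ratr (M 1 0).
have d0 : d != 0 by exact: mob_shift_neq0.
(* k has the sign of the derivative of mu at p *)
pose k := d * mob_den M (ratr (vx G)).
have k0 : k != 0 by rewrite mulf_neq0.
have shift : \forall x \near (ratr (vx G) : R),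
    exists2 r : R, 0 < r & mob M x - ratr (vx G) = r * k * (x - ratr (vx G)).
  have c : (fun x => mob_den M (ratr (vx G)) * mob_den M x) @ (ratr (vx G) : R) -->
           mob_den M (ratr (vx G)) * mob_den M (ratr (vx G)).
    by apply: cvgM; [exact: cvg_cst | exact: cvg_affine].
  have pos : 0 < mob_den M (ratr (vx G) : R) * mob_den M (ratr (vx G)).
    by rewrite -expr2 exprn_even_gt0.
  apply: filterS (cvgr_gt _ c _ pos) => x Px.
  have Dx : mob_den M x != 0 by apply: contraTneq Px => ->; rewrite mulr0 ltxx.
  exists (mob_den M (ratr (vx G)) * mob_den M x)^-1; first by rewrite invr_gt0.
  rewrite mob_shift // -/d /k; field; by rewrite Dp Dx.
have to_l l : branch Om G l -> 0 < k * ratr (opening m * opening l) -> same_pair E (std_of G m l).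
  move=> bl kl; apply: (self_equivalence_to_side R Om S) => //.
    by apply: contraTneq kl => ->; rewrite mulr0 rmorph0 mulr0 ltxx.
  apply: filterS shift => x [r r0 Er] mx; rewrite -/M Er.
  have -> : ratr (opening l) * (r * k * (x - ratr (vx G))) =
      r * (k * ratr (opening m * opening l)) * (ratr (opening m) * (x - ratr (vx G)))
        / ratr (opening m) ^+ 2.
    by rewrite rmorphM /=; field; rewrite fmorph_eq0.
  apply: divr_gt0; last by rewrite exprn_even_gt0 //= fmorph_eq0.
  by rewrite mulr_gt0 // mulr_gt0.
move: k0; rewrite neq_lt => /orP[] ks.
  by apply: to_l => //; rewrite nmulr_rgt0 // ltrq0.
exfalso; apply: Entriv.
have [Pmu EA EB] : same_pair E (std_of G m m).
  by apply: to_l => //; rewrite pmulr_rgt0 // ltr0q -expr2 exprn_even_gt0.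
have [Pmu' eA eB] := std_diag_trivial G m (lt0r_neq0 h0) dm.
by split; [exact: proportional_trans Pmu Pmu' | rewrite EA | rewrite EB].
Qed.

(** * Normal form of the triad *)

(** X-points are defined by rational abscissae, so a rational point is needed to
    separate the two functions. *)
Lemma side_rat_point (R : realType) (p : rat) (e : R) (P : R -> Prop) : e != 0 ->
  (\forall x \near (ratr p : R), 0 < e * (x - ratr p) -> P x) ->
  exists2 q : rat, 0 < e * (ratr q - ratr p) & P (ratr q).
Proof.
move=> e0 /nbhs_ballP[r /= r0 H].
have [s] := rat_in_itvoo r0; rewrite in_itv /= => /andP[s0 sr].
move: e0; rewrite neq_lt => /orP[] e0.
- have E : ratr (p - s) - ratr p = - ratr s :> R by rewrite rmorphB /= addrAC subrr add0r.
  have es : 0 < e * (ratr (p - s) - ratr p) by rewrite E nmulr_rgt0 // oppr_lt0.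
  by exists (p - s) => //; apply: H => //; rewrite /ball /= -opprB E opprK gtr0_norm.
- have E : ratr (p + s) - ratr p = ratr s :> R by rewrite rmorphD /= addrAC subrr add0r.
  have es : 0 < e * (ratr (p + s) - ratr p) by rewrite E mulr_gt0.
  by exists (p + s) => //; apply: H => //; rewrite /ball /= -opprB E normrN gtr0_norm.
Qed.

(** I - J is the nonnegative difference of the maximum and the minimum, and it does
    not vanish at rational points other than the X-point. *)
Lemma X_point_opening (R : realType) (f g : R -> R) G m (e : R) :
  X_point f g (vx G) -> e != 0 ->
  (\forall x \near (ratr (vx G) : R), 0 < e * (x - ratr (vx G)) ->
     Num.max (f x) (g x) = evalq (lineI G m) x /\
     Num.min (f x) (g x) = evalq (lineJ G m) x) ->
  0 < e * ratr (opening m).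
Proof.
move=> [d d0 Xfg] e0 H.
have near_d : \forall x \near (ratr (vx G) : R), x \in `]ratr (vx G) - d, ratr (vx G) + d[.
  apply/nbhs_ballP; exists d => //= x; rewrite /ball /= => xd.
  by rewrite in_itv /= -ltr_distlC.
have H' : \forall x \near (ratr (vx G) : R), 0 < e * (x - ratr (vx G)) ->
    (x \in `]ratr (vx G) - d, ratr (vx G) + d[) /\
     Num.max (f x) (g x) = evalq (lineI G m) x /\
     Num.min (f x) (g x) = evalq (lineJ G m) x.
  by apply: filterS2 near_d H => x xd Hx /Hx.
have [q eq [qd [maxE minE]]] := side_rat_point R (vx G) e _ e0 H'.
have fg : f (ratr q) != g (ratr q).
  apply/eqP => fg; have : [set (vx G)]%classic q by rewrite -Xfg; split.
  by move=> /= E; move: eq; rewrite E subrr mulr0 ltxx.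
have : 0 < evalq (lineI G m) (ratr q : R) - evalq (lineJ G m) (ratr q).
  rewrite -maxE -minE subr_gt0 /Order.max /Order.min.
  by move: fg; case: (ltgtP (f (ratr q)) (g (ratr q))) => [|| ->]; rewrite ?eqxx.
have -> : evalq (lineI G m) (ratr q : R) - evalq (lineJ G m) (ratr q) =
    ratr (opening m) * (ratr q - ratr (vx G)).
  by rewrite !evalq_line /opening rmorphB /=; ring.
set t := _ - _ in eq *; move=> op.
have t2 : 0 < t ^+ 2 by rewrite exprn_even_gt0 //=; apply: contraTneq eq => ->; rewrite mulr0 ltxx.
have E : e * ratr (opening m) * t ^+ 2 = (e * t) * (ratr (opening m) * t) by ring.
by rewrite -(pmulr_lgt0 _ t2) E mulr_gt0.
Qed.

(** The left branch says nothing at the point itself, where its value comes from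
    continuity. *)
Lemma eq_at_of_left (R : realType) (p : R) (f g : R -> R) :
  f x @[x --> p] --> f p -> g x @[x --> p] --> g p ->
  (\forall x \near p, x < p -> f x = g x) -> f p = g p.
Proof.
move=> cf cg H; apply/eqP; rewrite -subr_eq0; apply: contraT => fg0.
have c := cvgr_neq0 _ (cvgB cf cg) fg0.
have H' : \forall x \near p, 0 < - 1 * (x - p) -> False.
  near=> x; rewrite mulN1r opprB subr_gt0 => xp.
  have E : f x = g x by move: xp; near: x.
  have : f x - g x != 0 by near: x; exact: c.
  by rewrite E subrr eqxx.
have N1 : (- 1 : R) != 0 by rewrite oppr_eq0 oner_eq0.
by have [u _ /(_ 0%N)] := side_points R p (- 1) (fun=> False) N1 H'.
Unshelve. all: by end_near. Qed.

Lemma triad_max_min (R : realType) (f g h : R -> R) x :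
  perm_eq (triad f g h x) [:: Num.max (f x) (g x); Num.min (f x) (g x); h x].
Proof.
rewrite /triad /Order.max /Order.min; case: ifP => _ //.
by apply/permP => P /=; rewrite addnCA.
Qed.

Lemma cvg_fun_max (R : realType) (f g : R -> R) : continuous f -> continuous g ->
  forall x : R, Num.max (f y) (g y) @[y --> x] --> Num.max (f x) (g x).
Proof. by move=> cf cg x; apply: continuous_max; [exact: cf | exact: cg]. Qed.

Lemma cvg_fun_min (R : realType) (f g : R -> R) : continuous f -> continuous g ->
  forall x : R, Num.min (f y) (g y) @[y --> x] --> Num.min (f x) (g x).
Proof. by move=> cf cg x; apply: continuous_min; [exact: cf | exact: cg]. Qed.

Lemma cvg_evalq_affine (R : realType) (q : {poly rat}) (p : rat) : affine q ->
  evalq q x @[x --> (ratr p : R)] --> evalq q (ratr p : R).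
Proof. by move=> aq; rewrite (affineE q p aq); exact: cvg_evalq_line. Qed.

(** The six affine functions are reduced to nine numbers, because continuity makes the
    branches on the two sides agree at the X-point. *)
Lemma triad_normal_form (R : realType) (p : rat) (Yi Yj Y : R -> R)
    (I J K I' J' K' : {poly rat}) :
  continuous Yi -> continuous Yj -> continuous Y ->
  X_point Yi Yj p -> Yi (ratr p) < Y (ratr p) ->
  affine I -> affine J -> affine K -> affine I' -> affine J' -> affine K' ->
  (\forall x \near (ratr p : R), ratr p <= x ->
       [/\ Num.max (Yi x) (Yj x) = evalq I x,
           Num.min (Yi x) (Yj x) = evalq J x & Y x = evalq K x]) ->
  (\forall x \near (ratr p : R), x < ratr p ->
       [/\ Num.max (Yi x) (Yj x) = evalq I' x,
           Num.min (Yi x) (Yj x) = evalq J' x & Y x = evalq K' x]) ->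
  exists G m n,
    [/\ p = vx G, 0 < gap G,
       [/\ I = lineI G m, J = lineJ G m & K = lineK G m] &
       [/\ I' = lineI G n, J' = lineJ G n & K' = lineK G n]].
Proof.
move=> cYi cYj cY Xp aux aI aJ aK aI' aJ' aK' right_ left_.
have Yp : Yi (ratr p) = Yj (ratr p).
  have [e _ /seteqP[_ /(_ p erefl)]] := Xp.
  by case.
have [eI eJ eK] := nbhs_singleton right_ (lexx _).
have eI' : Num.max (Yi (ratr p)) (Yj (ratr p)) = evalq I' (ratr p).
  apply: (eq_at_of_left _ _ (fun x => Num.max (Yi x) (Yj x)) (evalq I')).
  - exact: cvg_fun_max.
  - exact: cvg_evalq_affine.
  - by apply: filterS left_ => x H /H[].
have eJ' : Num.min (Yi (ratr p)) (Yj (ratr p)) = evalq J' (ratr p).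
  apply: (eq_at_of_left _ _ (fun x => Num.min (Yi x) (Yj x)) (evalq J')).
  - exact: cvg_fun_min.
  - exact: cvg_evalq_affine.
  - by apply: filterS left_ => x H /H[].
have eK' : Y (ratr p) = evalq K' (ratr p).
  apply: (eq_at_of_left _ _ Y (evalq K')).
  - exact: cY.
  - exact: cvg_evalq_affine.
  - by apply: filterS left_ => x H /H[].
have inj := fmorph_inj (ratr : rat -> R).
move: eI eJ eK eI' eJ' eK'; rewrite -Yp maxxx minxx !evalq_ratr => eI eJ eK eI' eJ' eK'.
have JI : J.[p] = I.[p] by apply: inj; rewrite /= -eJ.
have II : I'.[p] = I.[p] by apply: inj; rewrite /= -eI'.
have JJ : J'.[p] = I.[p] by apply: inj; rewrite /= -eJ'.
have KK : K'.[p] = K.[p] by apply: inj; rewrite /= -eK'.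
exists (Frame p I.[p] (K.[p] - I.[p])), (Slopes I`_1 J`_1 K`_1), (Slopes I'`_1 J'`_1 K'`_1).
split=> //=.
- by move: aux; rewrite eI eK ltr_rat subr_gt0.
- split; rewrite /lineI /lineJ /lineK /= ?(addrC I.[p]) ?subrK.
  + exact: affineE.
  + by rewrite -JI; exact: affineE.
  + exact: affineE.
- split; rewrite /lineI /lineJ /lineK /= ?(addrC I.[p]) ?subrK.
  + by rewrite -II; exact: affineE.
  + by rewrite -JJ; exact: affineE.
  + by rewrite -KK; exact: affineE.
Qed.

Theorem theorem4 (R : realType) (p : rat) (Yi Yj Y : R -> R)
    (I J K I' J' K' : {poly rat})
    (pa_Yi : piecewise_affine Yi) (pa_Yj : piecewise_affine Yj)
    (pa_Y : piecewise_affine Y)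
    (reg_Yi : regular_off Yi (ratr p)) (reg_Yj : regular_off Yj (ratr p))
    (reg_Y : regular_off Y (ratr p))
    (Xp : X_point Yi Yj p)
    (aux_Y : Yi (ratr p) < Y (ratr p))
    (aff_I : affine I) (aff_J : affine J) (aff_K : affine K)
    (aff_I' : affine I') (aff_J' : affine J') (aff_K' : affine K')
    (right_branch : \forall x \near (ratr p : R), ratr p <= x ->
       [/\ Num.max (Yi x) (Yj x) = evalq I x,
           Num.min (Yi x) (Yj x) = evalq J x & Y x = evalq K x])
    (left_branch : \forall x \near (ratr p : R), x < ratr p ->
       [/\ Num.max (Yi x) (Yj x) = evalq I' x,
           Num.min (Yi x) (Yj x) = evalq J' x & Y x = evalq K' x]) :
  let Om := triad Yi Yj Y in
  let axis := join (pt p I.[p]) o_infty in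
  let determined (lam : 'M[rat]_3) :=
    [/\ homology lam axis,
        (graph_line I *m lam == graph_line I')%MS,
        (graph_line J *m lam == graph_line J')%MS &
        (graph_line K *m lam == graph_line K')%MS] in
  let E := std_pair I J K I' J' K' in
  let E' := std_pair I' J' K' I J K in
  let right : pred R := fun x => ratr p <= x in
  let left : pred R := fun x => x < ratr p in
  [/\ (* order of the branches *)
      (\forall x \near (ratr p : R),
         (ratr p < x -> evalq J x < evalq I x /\ evalq I x < evalq K x) /\
         (x < ratr p -> evalq J' x < evalq I' x /\ evalq I' x < evalq K' x)),
      (* the homology, unique as a collineation, and the pair it induces *)
      exists lam : 'M[rat]_3,
        [/\ determined lam,
            forall lam' : 'M[rat]_3, determined lam' -> proportional lam' lam &
            induces lam E],
      (* the self-equivalence, the second pair being the inverse *)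
      [/\ self_equivalence p right Om E,
          self_equivalence p left Om E',
          inverse_pair R p E E' &
          \forall x \near (ratr p : R),
            (ratr p <= x -> mob (mp_mu E) x <= ratr p /\
               maps_branches E x I J K I' J' K') /\
            (x < ratr p -> ratr p <= mob (mp_mu E') x /\
               maps_branches E' x I' J' K' I J K)],
      (* non-triviality *)
      ~ same_pair E trivial_pair /\ ~ same_pair E' trivial_pair &
      (* uniqueness up to inversion *)
      forall E1 : mpair, ~ same_pair E1 trivial_pair ->
        (self_equivalence p right Om E1 -> same_pair E1 E) /\
        (self_equivalence p left Om E1 -> same_pair E1 E')].
Proof.
have [G [m [n [Ep h0 [EI EJ EK] [EI' EJ' EK']]]]] :=
  triad_normal_form R p Yi Yj Y I J K I' J' K' pa_Yi.1 pa_Yj.1 pa_Y.1 Xp aux_Y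
    aff_I aff_J aff_K aff_I' aff_J' aff_K' right_branch left_branch.
subst p I J K I' J' K'.
have hn0 := lt0r_neq0 h0.
have om : 0 < opening m.
  rewrite -(ltr0q R) -[ltRHS]mul1r; apply: (X_point_opening R Yi Yj G) => //.
  apply: filterS right_branch => x H; rewrite mul1r subr_gt0 => /ltW /H[? ? _].
  by split.
have on : opening n < 0.
  have : 0 < - 1 * ratr (opening n) :> R.
    apply: (X_point_opening R Yi Yj G) => //.
    apply: filterS left_branch => x H; rewrite mulN1r opprB subr_gt0 => /H[? ? _].
    by split.
  by rewrite mulN1r oppr_gt0 ltrq0.
have dm := lt0r_neq0 om; have dn : opening n != 0 by rewrite lt_eqF.
have omn : opening m * opening n < 0 by rewrite pmulr_rlt0.
have onm : opening n * opening m < 0 by rewrite mulrC.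
have sideR (x : R) : side G m x = (ratr (vx G) <= x).
  by rewrite /side pmulr_rge0 ?ltr0q // subr_ge0.
have sideL (x : R) : side G n x = (x <= ratr (vx G)).
  by rewrite /side nmulr_rge0 ?ltrq0 // subr_le0.
have openR (x : R) : (0 < ratr (opening m) * (x - ratr (vx G))) = (ratr (vx G) < x).
  by rewrite pmulr_rgt0 ?ltr0q // subr_gt0.
have openL (x : R) : (0 < ratr (opening n) * (x - ratr (vx G))) = (x < ratr (vx G)).
  by rewrite nmulr_rgt0 ?ltrq0 // subr_lt0.
have bm : branch (triad Yi Yj Y) G m.
  apply: filterS right_branch => x H; rewrite sideR => /H[<- <- <-].
  exact: triad_max_min.
have bn : branch (triad Yi Yj Y) G n.
  apply: filterS2 left_branch bm => x H Hm; rewrite sideL le_eqVlt => /orP[/eqP xp|/H[<- <- <-]].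
    have := Hm; rewrite sideR xp lexx => /(_ isT).
    by rewrite !evalq_line subrr !mulr0.
  exact: triad_max_min.
split.
- apply: filterS2 (near_order R G m h0) (near_order R G n h0).
  move=> x [IK _ oi] [IK' _ oi']; split; rewrite -?openR -?openL -?oi -?oi' subr_gt0 => ?;
    by split.
- exists (hom_mx G m n).
  have Ip : (lineI G m).[vx G] = vy G by rewrite horner_line subrr mulr0 addr0.
  have [lamI lamJ lamK] := hom_mx_determined G m n hn0 dm dn.
  rewrite Ip; split.
  + split=> //; apply: hom_mx_homology => //.
    by rewrite gt_eqF // (lt_trans on).
  + move=> M [homM /andP[MI _] /andP[MJ _] /andP[MK _]].
    exact: hom_mx_unique.
  + exact: hom_mx_induces.
- split.
  + by apply: std_self_equivalence => // x; rewrite sideR.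
  + by apply: std_self_equivalence => // x; rewrite sideL => /ltW.
  + exact: std_inverse.
  + apply: filterS2 (near_std_side R G m n h0 dn) (near_std_side R G n m h0 dm).
    move=> x [D0 s] [D0' s']; rewrite sideR sideL in s; rewrite sideR sideL in s'.
    split=> [xp|/ltW xp]; split;
      [exact: s | exact: std_maps_branches | exact: s' | exact: std_maps_branches].
- by split; exact: std_nontrivial.
- move=> E1 ntriv; split=> selfE.
  + by apply: (self_equivalence_unique R _ _ G m n E1 h0 omn _ bm bn selfE) => // x;
      rewrite openR => /ltW.
  + by apply: (self_equivalence_unique R _ _ G n m E1 h0 onm _ bn bm selfE) => // x;
      rewrite openL.
Qed.
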